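(* Let $\mu_0$ be the probability measure whose moments are $\binom{3n}{n}\frac{1}{n+1}$, $n\ge0$. Then $\mu_0=\mu_1\boxplus\mu_2$, where $\mu_1=\mathbf{D}_2\varpi_{1/2}$, i.e. \[ \mu_1=\tfrac12\delta_0+\frac{\sqrt{8-(x-3)^2}}{4\pi x}\chi_{(3-\sqrt8,\,3+\sqrt8)}(x)\,dx, \] and $\mu_2=\tfrac12\delta_0+\tfrac12\varpi_1$, i.e. \[ \mu_2=\tfrac12\delta_0+\frac{\sqrt{4x-x^2}}{4\pi x}\chi_{(0,4)}(x)\,dx. \] Moreover $\mu_1$ and $\mu_2$ are infinitely divisible with respect to $\boxplus$, and consequently so is $\mu_0$.
   Context: For a compactly supported probability measure $\mu$ on $\mathbb{R}$, let $s_m(\mu)=\int t^m\,d\mu(t)$ and $M_\mu(z)=\sum_{m\ge0}s_m(\mu)z^m$. The $R$-transform $R_\mu$ is defined near $0$ by $R_\mu(zM_\mu(z))+1=M_\mu(z)$. The additive free convolution $\mu'\boxplus\mu''$ is the unique compactly supported probability measure with $R_{\mu'\boxplus\mu''}=R_{\mu'}+R_{\mu''}$. A measure $\mu$ is $\boxplus$-infinitely divisible if for every $N\ge1$ there is a probability measure $\nu_N$ with $\nu_N^{\boxplus N}=\mu$. For $c>0$, the dilation is $\mathbf{D}_c\mu(A)=\mu(A/c)$. For $t>0$, the Marchenko–Pastur distribution is \[ \varpi_t=\max\{1-t,0\}\delta_0+\frac{\sqrt{4t-(x-1-t)^2}}{2\pi x}\,dx, \] with absolutely continuous part on $[(1-\sqrt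 t)^2,(1+\sqrt t)^2]$. It has $R_{\varpi_t}(z)=\frac{tz}{1-z}$. *)

(* Defs.v *)
From HB Require Import structures.
From mathcomp Require Import all_boot all_order all_algebra.
From mathcomp Require Import all_classical all_reals all_analysis.
Set Implicit Arguments. Unset Strict Implicit. Unset Printing Implicit Defensive.
Import Order.TTheory GRing.Theory Num.Theory.
Import numFieldNormedType.Exports.
Local Open Scope classical_set_scope.
Local Open Scope ring_scope.

Section FreeProb.
Variable R : realType.

Definition moment (mu : probability R R) (m : nat) : \bar R :=
  (\int[mu]_t (t ^+ m)%:E)%E.

Definition compactly_supported (mu : probability R R) : Prop :=
  exists C : R, mu [set x : R | C < `|x|] = 0%E.

Definition Mterm (mu : probability R R) (z : R) : nat -> R :=
  fun m => fine (moment mu m) * z ^+ m.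
Definition Mseries (mu : probability R R) (z : R) : R :=
  lim (series (Mterm mu z) @ \oo).

(* Rf is (a representative of the germ at 0 of) the R-transform of mu:
   R_mu(z M_mu(z)) + 1 = M_mu(z) for all z near 0 (series convergent there). *)
Definition is_Rtransform (mu : probability R R) (Rf : R -> R) : Prop :=
  exists2 eps : R, 0 < eps &
    forall z : R, `|z| < eps ->
      cvg (series (Mterm mu z) @ \oo) /\
      Rf (z * Mseries mu z) + 1 = Mseries mu z.

Definition is_free_conv (mu mu1 mu2 : probability R R) : Prop :=
  [/\ compactly_supported mu, compactly_supported mu1,
      compactly_supported mu2 &
  exists R0 R1 R2 : R -> R,
    [/\ is_Rtransform mu R0, is_Rtransform mu1 R1, is_Rtransform mu2 R2 &
    exists2 eps : R, 0 < eps &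
      forall w : R, `|w| < eps -> R0 w = R1 w + R2 w]].

(* free_powS nu n mu  <->  nu^{[+](n+1)} = mu *)
Fixpoint free_powS (nu : probability R R) (n : nat) (mu : probability R R)
  : Prop :=
  match n with
  | 0%N => forall A : set R, measurable A -> mu A = nu A
  | n'.+1 => exists mu' : probability R R,
      free_powS nu n' mu' /\ is_free_conv mu mu' nu
  end.

Definition free_inf_divisible (mu : probability R R) : Prop :=
  forall N : nat, (0 < N)%N ->
    exists nu : probability R R, free_powS nu N.-1 mu.

Definition mp_density (t x : R) : R :=
  if ((1 - Num.sqrt t) ^+ 2 <= x) && (x <= (1 + Num.sqrt t) ^+ 2) then
    Num.sqrt (4 * t - (x - 1 - t) ^+ 2) / (2 * pi * x)
  else 0.

Definition marchenko_pastur (t : R) (A : set R) : \bar R :=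
  ((Num.max (1 - t) (0%R:R))%:E * \d_(0%R:R) A +
   \int[lebesgue_measure]_(x in A) (mp_density t x)%:E)%E.

Definition dilation (c : R) (nu : set R -> \bar R) (A : set R) : \bar R :=
  nu [set a / c | a in A].

End FreeProb.

(* Main.v *)
Require Import Defs.
From HB Require Import structures.
From mathcomp Require Import all_boot all_order all_algebra.
From mathcomp Require Import all_classical all_reals all_analysis.
From mathcomp Require Import measurable_realfun ring lra zify.
Set Implicit Arguments. Unset Strict Implicit. Unset Printing Implicit Defensive.
Import Order.TTheory GRing.Theory Num.Theory.
Import numFieldNormedType.Exports.
Local Open Scope classical_set_scope.
Local Open Scope ring_scope.

(* All the R-transforms involved are of the form
     R(w) = s ((1 - 2w)^-1 - 1) + t ((1 - 2w)^(-1/2) - 1),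
   with (s, t) = (1/2, 0) for mu1, (0, 1/2) for mu2 and (1/2, 1/2) for mu0, so everything reduces to
   identifying these three transforms and to constructing, for all s, t >= 0, a measure with this transform.
   Put 1 + 2 zeta := (1 - 2 z M(z))^(-1/2). Then M is a polynomial in zeta, and the pair (zeta, M) is the
   only power series solution of an algebraic system ([zeta_rel]); the moments of mu0 (Fuss-Catalan numbers),
   mu1 and mu2 (semicircle integrals) are recognized by uniqueness.
   For existence, the generating function A(u, v) = (u M(u) - v M(v)) / (u - v) of the Hankel matrix of M
   satisfies A = M(u) M(v) (1 + u v N A), where N is visibly a positive-definite kernel in terms of zeta
   when s, t >= 0. So the Hankel matrices are positive semidefinite, by induction on their size, and the
   geometrically bounded Hamburger moment problem has a solution: Bernstein weights give discrete measures
   whose quantile functions converge along an ultrafilter to the quantile function of the measure. *)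

(** * Formal power series *)

(** The kernel N is the divided difference of R(w)/w between w = u M(u) and w' = v M(v). If R(w) is
    the sum of the k_n w^n, then N is the sum of the k_(i+j+2) w^i w'^j, so its positivity is the
    positivity condition on free cumulants that characterizes infinite divisibility. Written in
    zeta, N consists of rank-one kernels and one geometric series, and its sign can be read off.
    Measures are needed for all s, t >= 0 and not only for the roots themselves: a free power is
    built by successive binary convolutions, so each partial power needs a measure of its own, and
    no explicit density is at hand for those. *)

Record fps (R : Type) := Fps { fpscoef : nat -> R }.

HB.instance Definition _ (R : Type) := gen_eqMixin (fps R).
HB.instance Definition _ (R : Type) := gen_choiceMixin (fps R).

Notation "f `@_ n" := (fpscoef f n) (at level 3, n at level 2, left associativity, format "f `@_ n").

Lemma fpsP (R : Type) (f g : fps R) : (forall n, f`@_n = g`@_n) -> f = g.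
Proof. by case: f g => [f] [g] /= /funext ->. Qed.

Section FpsRing.
Variable R : comNzRingType.
Implicit Types f g h : fps R.

Definition fps_zero : fps R := Fps (fun=> 0).
Definition fps_one : fps R := Fps (fun n => (n == 0%N)%:R).
Definition fps_opp f : fps R := Fps (fun n => - f`@_n).
Definition fps_add f g : fps R := Fps (fun n => f`@_n + g`@_n).
Definition fps_mul f g : fps R :=
  Fps (fun n => \sum_(i < n.+1) f`@_i * g`@_(n - i)).

Fact fps_addA : associative fps_add.
Proof. by move=> f g h; apply: fpsP => n /=; rewrite addrA. Qed.
Fact fps_addC : commutative fps_add.
Proof. by move=> f g; apply: fpsP => n /=; rewrite addrC. Qed.
Fact fps_add0 : left_id fps_zero fps_add.
Proof. by move=> f; apply: fpsP => n /=; rewrite add0r. Qed.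
Fact fps_addN : left_inverse fps_zero fps_opp fps_add.
Proof. by move=> f; apply: fpsP => n /=; rewrite addNr. Qed.

HB.instance Definition _ :=
  GRing.isZmodule.Build (fps R) fps_addA fps_addC fps_add0 fps_addN.

Definition fps_trunc n f : {poly R} := \poly_(i < n) f`@_i.

Lemma coef_fps_trunc n f i : (i < n)%N -> (fps_trunc n f)`_i = f`@_i.
Proof. by rewrite coef_poly => ->. Qed.

(* The ring laws of power series are read off those of polynomials, coefficient by coefficient. *)
Lemma fps_mul_poly n f g (p q : {poly R}) :
    (forall i, (i < n)%N -> p`_i = f`@_i) ->
    (forall i, (i < n)%N -> q`_i = g`@_i) ->
  forall i, (i < n)%N -> (p * q)`_i = (fps_mul f g)`@_i.
Proof.
move=> pf qg i lin; rewrite coefM /=; apply: eq_bigr => -[j /= ltj] _.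
by rewrite pf ?qg//; lia.
Qed.

Fact fps_mulA : associative fps_mul.
Proof.
move=> f g h; apply: fpsP => n.
have E := coef_fps_trunc (n := n.+1).
rewrite -(@fps_mul_poly n.+1 _ _ (fps_trunc n.+1 f) (fps_trunc n.+1 g * fps_trunc n.+1 h))//; last first.
- by apply: fps_mul_poly; exact: E.
- exact: E.
rewrite -(@fps_mul_poly n.+1 _ _ (fps_trunc n.+1 f * fps_trunc n.+1 g) (fps_trunc n.+1 h)) ?mulrA//.
- by apply: fps_mul_poly; exact: E.
- exact: E.
Qed.

Fact fps_mulC : commutative fps_mul.
Proof.
move=> f g; apply: fpsP => n.
have E a b : (fps_mul a b)`@_n = (fps_trunc n.+1 a * fps_trunc n.+1 b)`_n.
  by apply/esym/(@fps_mul_poly n.+1) => // i; exact: coef_fps_trunc.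
by rewrite !E mulrC.
Qed.

Fact fps_mul1 : left_id fps_one fps_mul.
Proof.
move=> f; apply: fpsP => n /=; rewrite big_ord_recl /= mul1r subn0 big1 ?addr0//.
by move=> i _; rewrite mul0r.
Qed.

Fact fps_mulDl : left_distributive fps_mul fps_add.
Proof.
move=> f g h; apply: fpsP => n /=; rewrite -big_split/=; apply: eq_bigr => i _.
by rewrite mulrDl.
Qed.

Fact fps_one_neq0 : fps_one != fps_zero.
Proof. by apply/eqP => /(congr1 (fun f => f`@_0%N))/eqP; rewrite /= oner_eq0. Qed.

HB.instance Definition _ := GRing.Zmodule_isComNzRing.Build (fps R)
  fps_mulA fps_mulC fps_mul1 fps_mulDl fps_one_neq0.

Lemma fpscoef0 n : (0 : fps R)`@_n = 0. Proof. by []. Qed.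
Lemma fpscoefD f g n : (f + g)`@_n = f`@_n + g`@_n. Proof. by []. Qed.
Lemma fpscoefN f n : (- f)`@_n = - f`@_n. Proof. by []. Qed.
Lemma fpscoefB f g n : (f - g)`@_n = f`@_n - g`@_n. Proof. by []. Qed.
Lemma fpscoefM f g n : (f * g)`@_n = \sum_(i < n.+1) f`@_i * g`@_(n - i).
Proof. by []. Qed.
Lemma fpscoefM0 f g : (f * g)`@_0 = f`@_0 * g`@_0.
Proof. by rewrite fpscoefM big_ord_recl big_ord0 addr0. Qed.
Lemma fpscoef_sum I (r : seq I) (P : pred I) (F : I -> fps R) n :
  (\sum_(i <- r | P i) F i)`@_n = \sum_(i <- r | P i) (F i)`@_n.
Proof. by elim/big_rec2: _ => //= i x y _ <-. Qed.

Definition fpsC (a : R) : fps R := Fps (fun n => a *+ (n == 0%N)).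
Definition fpsX : fps R := Fps (fun n => (n == 1%N)%:R).

Lemma fpscoefC a n : (fpsC a)`@_n = a *+ (n == 0%N). Proof. by []. Qed.

Lemma fpscoefCM a f n : (fpsC a * f)`@_n = a * f`@_n.
Proof.
rewrite fpscoefM big_ord_recl /= mulr1n subn0 big1 ?addr0// => i _.
by rewrite mulr0n mul0r.
Qed.

Lemma fpscoefXM f n : (fpsX * f)`@_n = if n is m.+1 then f`@_m else 0.
Proof.
case: n => [|n]; first by rewrite fpscoefM0 mul0r.
rewrite fpscoefM big_ord_recl big_ord_recl /= mul0r add0r mul1r subSS subn0.
by rewrite big1 ?addr0// => i _; rewrite /bump/= mul0r.
Qed.

Lemma fpsC1 : fpsC 1 = 1. Proof. exact: fpsP. Qed.
Lemma fpsCM a b : fpsC (a * b) = fpsC a * fpsC b.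
Proof. by apply: fpsP => n; rewrite fpscoefCM !fpscoefC mulrnAr. Qed.
Lemma fpsCB a b : fpsC (a - b) = fpsC a - fpsC b.
Proof. by apply: fpsP => n; rewrite fpscoefB !fpscoefC mulrnBl. Qed.

HB.instance Definition _ := GRing.isZmodMorphism.Build R (fps R) fpsC fpsCB.
HB.instance Definition _ := GRing.isMonoidMorphism.Build R (fps R) fpsC (fpsC1, fpsCM).

Lemma fps_shift f : f`@_0 = 0 -> exists g, f = fpsX * g.
Proof.
move=> f0; exists (Fps (fun n => f`@_n.+1)); apply: fpsP => -[|n].
  by rewrite fpscoefXM.
by rewrite fpscoefXM.
Qed.

Lemma fpsX_inj f g : fpsX * f = fpsX * g -> f = g.
Proof.
move=> fg; apply: fpsP => n.
by have := congr1 (fun f => f`@_n.+1) fg; rewrite !fpscoefXM.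
Qed.

Definition fpseq n f g := forall i, (i < n)%N -> f`@_i = g`@_i.

Lemma fpseq_refl n f : fpseq n f f. Proof. by []. Qed.
Lemma fpseqD n f g f' g' : fpseq n f f' -> fpseq n g g' -> fpseq n (f + g) (f' + g').
Proof. by move=> e1 e2 i lti; rewrite !fpscoefD e1 ?e2. Qed.
Lemma fpseqN n f f' : fpseq n f f' -> fpseq n (- f) (- f').
Proof. by move=> e1 i lti; rewrite !fpscoefN e1. Qed.
Lemma fpseqM n f g f' g' : fpseq n f f' -> fpseq n g g' -> fpseq n (f * g) (f' * g').
Proof.
move=> e1 e2 i lti; rewrite !fpscoefM; apply: eq_bigr => -[j/= ltj] _.
by rewrite e1 ?e2//; lia.
Qed.
Lemma fpseqXM n f g : fpseq n f g -> fpseq n.+1 (fpsX * f) (fpsX * g).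
Proof. by move=> e [|i] lti; rewrite !fpscoefXM// e. Qed.

(** [fpseq n] is congruence modulo X^n, so this is contraction for the X-adic metric, and the next
    two lemmas are the Banach fixed point theorem. In the existence proof, coefficient n no longer
    changes from iterate n + 1 on, and the limit is read on the diagonal. *)
Definition fps_contractive (F : fps R -> fps R) :=
  forall n f g, fpseq n f g -> fpseq n.+1 (F f) (F g).

Lemma fps_fixpoint F : fps_contractive F -> exists f, F f = f.
Proof.
move=> cF; have step k n : (n < k)%N -> fpseq n.+1 (iter k F 0) (iter n.+1 F 0).
  elim: n k => [|n IHn] [|k]// ltnk.
    by rewrite !iterS/=; apply: cF.
  by rewrite !iterS; apply: cF; exact: IHn.
exists (Fps (fun n => (iter n.+1 F 0)`@_n)); apply: fpsP => n /=.
apply: (@cF n) => // i lti /=; apply/esym/step => //.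
Qed.

Lemma fps_fixpoint_uniq F f g : fps_contractive F -> F f = f -> F g = g -> f = g.
Proof.
move=> cF Ff Fg; suff e n : fpseq n f g by apply: fpsP => n; exact: (e n.+1).
by elim: n => // n; move=> /cF; rewrite Ff Fg.
Qed.

(** With f = 1 + X h, the inverse is the fixed point of g |-> 1 - X h g. No field is required, so
    this also inverts series whose coefficients are series. *)
Lemma fps_inv f : f`@_0 = 1 -> exists g, f * g = 1.
Proof.
move=> f0; have [h hE] : exists h, f - 1 = fpsX * h.
  by apply: fps_shift; rewrite fpscoefB f0 subrr.
have [g gE] : exists g, 1 - fpsX * (h * g) = g.
  apply: fps_fixpoint => n a b ab; apply: fpseqD => //; apply: fpseqN.
  by apply: fpseqXM; apply: fpseqM.
exists g; have -> : f = 1 + fpsX * h by rewrite -hE addrC subrK.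
by rewrite mulrDl mul1r -{1}gE -mulrA subrK.
Qed.

End FpsRing.

(** * Positive-definite kernels as bivariate power series *)

Section Bivariate.
Variable R : comNzRingType.
Implicit Types (f g : fps R) (K : fps (fps R)).

(* In [fps (fps R)] the outer variable is u and the inner one is v. *)
Definition fpsU f : fps (fps R) := Fps (fun n => fpsC f`@_n).
Definition fpsV f : fps (fps R) := fpsC f.

Lemma fpsUB f g : fpsU (f - g) = fpsU f - fpsU g.
Proof. by apply: fpsP => n /=; rewrite -fpsCB. Qed.
Lemma fpsU1 : fpsU 1 = 1.
Proof. by apply: fpsP => n; apply: fpsP => -[|m]; case: n => //=; rewrite mul0rn. Qed.
Lemma fpsUM f g : fpsU (f * g) = fpsU f * fpsU g.
Proof.
apply: fpsP => n; rewrite [RHS]fpscoefM /= rmorph_sum/=; apply: eq_bigr => i _.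
by rewrite fpsCM.
Qed.

HB.instance Definition _ := GRing.isZmodMorphism.Build _ _ fpsU fpsUB.
HB.instance Definition _ := GRing.isMonoidMorphism.Build _ _ fpsU (fpsU1, fpsUM).
HB.instance Definition _ := GRing.isZmodMorphism.Build _ _ fpsV (@fpsCB _).
HB.instance Definition _ := GRing.isMonoidMorphism.Build _ _ fpsV (@fpsC1 _, @fpsCM _).

Lemma fpsUC (a : R) : fpsU (fpsC a) = fpsV (fpsC a).
Proof. by apply: fpsP => -[|n]; apply: fpsP => -[|m]//=; rewrite ?mulr0n. Qed.

Lemma fpsUX : fpsU (fpsX R) = fpsX _.
Proof. by apply: fpsP => n /=; rewrite rmorph_nat. Qed.

Lemma fpscoefUV f g m n : (fpsU f * fpsV g)`@_m`@_n = f`@_m * g`@_n.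
Proof. by rewrite [fpsU f * _]mulrC /fpsV fpscoefCM [g * _]mulrC fpscoefCM. Qed.

Lemma fpscoefUVM f g K m n : (fpsU f * fpsV g * K)`@_m`@_n =
  \sum_(i < m.+1) \sum_(j < n.+1) f`@_i * g`@_j * K`@_(m - i)`@_(n - j).
Proof.
rewrite -mulrA fpscoefM fpscoef_sum; apply: eq_bigr => i _.
rewrite [(fpsU f)`@_i]/= fpscoefCM /fpsV fpscoefCM fpscoefM mulr_sumr.
by apply: eq_bigr => j _; rewrite mulrA.
Qed.

Lemma fpscoefUVXM K m n : (fpsU (fpsX R) * fpsV (fpsX R) * K)`@_m`@_n =
  match m, n with m'.+1, n'.+1 => K`@_m'`@_n' | _, _ => 0 end.
Proof.
rewrite fpsUX -mulrA fpscoefXM; case: m => [|m]; first by [].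
by rewrite /fpsV fpscoefCM fpscoefXM; case: n.
Qed.

(** u - v is not a zero divisor: if (u - v) D = 0, the coefficients of D are constant along
    antidiagonals and vanish in row 0, which every antidiagonal meets. *)
Lemma fpsUVX_inj K L :
  (fpsU (fpsX R) - fpsV (fpsX R)) * K = (fpsU (fpsX R) - fpsV (fpsX R)) * L -> K = L.
Proof.
move=> /eqP; rewrite -subr_eq0 -mulrBr => /eqP D0; apply/eqP; rewrite -subr_eq0.
apply/eqP; move: (K - L) D0 => {K L} D D0.
have Dmn m n : (if m is m'.+1 then D`@_m'`@_n else 0) =
               (if n is n'.+1 then D`@_m`@_n' else 0).
  have : ((fpsU (fpsX R) - fpsV (fpsX R)) * D)`@_m`@_n = 0 by rewrite D0.
  rewrite mulrBl fpscoefB fpsUX fpscoefXM /fpsV fpscoefCM fpscoefXM.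
  by case: m => [|m] /eqP; rewrite subr_eq0 => /eqP.
apply: fpsP => m; apply: fpsP => n /=; elim: m n => [|m IH] n.
  by have := Dmn 0%N n.+1.
by have := Dmn m.+1 n.+1 => /= <-.
Qed.

End Bivariate.

Section Psd.
Variable R : realFieldType.
Implicit Types (f g : fps R) (K : fps (fps R)).

(** Only the leading N x N block is constrained, so that positivity can be proved by induction on
    N. *)
Definition psd N K := forall c : nat -> R,
  0 <= \sum_(m < N) \sum_(n < N) c m * c n * K`@_m`@_n.

Lemma psdD N K L : psd N K -> psd N L -> psd N (K + L).
Proof.
move=> pK pL c; rewrite (_ : \sum_(_ < _) _ = \sum_(m < N) \sum_(n < N) c m * c n * K`@_m`@_n
 + \sum_(m < N) \sum_(n < N) c m * c n * L`@_m`@_n) ?addr_ge0//.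
rewrite -big_split/=; apply: eq_bigr => i _; rewrite -big_split/=; apply: eq_bigr => j _.
by rewrite mulrDr.
Qed.

Lemma psdZ N a K : 0 <= a -> psd N K -> psd N (fpsV (fpsC a) * K).
Proof.
move=> a0 pK c; rewrite (_ : \sum_(_ < _) _ = a * \sum_(m < N) \sum_(n < N) c m * c n * K`@_m`@_n).
  exact: mulr_ge0.
rewrite mulr_sumr; apply: eq_bigr => i _; rewrite mulr_sumr; apply: eq_bigr => j _.
by rewrite /fpsV !fpscoefCM; ring.
Qed.

Lemma psd_rank1 N f : psd N (fpsU f * fpsV f).
Proof.
move=> c; rewrite (_ : \sum_(_ < _) _ = (\sum_(m < N) c m * f`@_m) ^+ 2) ?sqr_ge0//.
rewrite expr2 mulr_suml; apply: eq_bigr => i _; rewrite mulr_sumr; apply: eq_bigr => j _.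
by rewrite fpscoefUV; ring.
Qed.

(** Multiplication by f(u) f(v) is the congruence by the lower triangular Toeplitz matrix [F] of f.
    Since [F] is triangular, the congruence restricts to leading blocks, and the quadratic form at c
    becomes that of K at d, the transpose of [F] applied to c. *)
Lemma psd_congr N f K : psd N K -> psd N (fpsU f * fpsV f * K).
Proof.
move=> pK c; pose F m i := if (i <= m)%N then f`@_(m - i) else 0.
have E m (h : nat -> R) : (m < N)%N ->
    \sum_(i < m.+1) f`@_i * h (m - i)%N = \sum_(i < N) F m i * h i.
  move=> mN; rewrite (reindex_inj rev_ord_inj)/=.
  rewrite [RHS](bigID (fun i : 'I_N => (i <= m)%N)) /= [X in _ + X]big1 ?addr0; last first.
    by move=> i; rewrite /F => /negbTE ->; rewrite mul0r.
  rewrite (big_ord_widen_cond N xpredT (fun i => f`@_(m.+1 - i.+1) * h (m - (m.+1 - i.+1))%N))//=.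
  apply: eq_big => [i|i im]; first by rewrite ltnS.
  by have im' : (i <= m)%N by []; rewrite /F im'; congr (_ * h _); lia.
pose d i := \sum_(m < N) c m * F m i.
rewrite (_ : \sum_(_ < _) _ = \sum_(i < N) \sum_(j < N) d i * d j * K`@_i`@_j)//.
transitivity (\sum_(m < N) \sum_(n < N) \sum_(i < N) \sum_(j < N)
    (c m * F m i) * (c n * F n j) * K`@_i`@_j).
  apply: eq_bigr => m _; apply: eq_bigr => n _; rewrite fpscoefUVM.
  under eq_bigr do under eq_bigr do rewrite -mulrA.
  under eq_bigr do rewrite -mulr_sumr.
  rewrite (E m (fun i => \sum_(j < n.+1) f`@_j * K`@_i`@_(n - j)))//.
  rewrite mulr_sumr; apply: eq_bigr => i _.
  rewrite (E n (fun j => K`@_i`@_j))// !mulr_sumr; apply: eq_bigr => j _; ring.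
under eq_bigr do rewrite exchange_big/=.
rewrite exchange_big/=; apply: eq_bigr => i _.
under eq_bigr do rewrite exchange_big/=.
rewrite exchange_big/=; apply: eq_bigr => j _.
rewrite /d [X in X * _]mulr_suml mulr_suml; apply: eq_bigr => m _.
by rewrite -mulr_suml -mulr_sumr.
Qed.

(** The factor u v moves the block one step down the diagonal and leaves row 0 and column 0 empty.
    The size gained here drives the inductions in [psd_hankel]. *)
Lemma psd_shift N K : psd N K -> psd N.+1 (fpsU (fpsX R) * fpsV (fpsX R) * K).
Proof.
move=> pK c; rewrite big_ord_recl/= big1 ?add0r => [|j _]; last first.
  by rewrite fpscoefUVXM mulr0.
rewrite (_ : \sum_(_ < _) _ = \sum_(m < N) \sum_(n < N) c m.+1 * c n.+1 * K`@_m`@_n).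
  exact: (pK (c \o succn)).
apply: eq_bigr => i _; rewrite big_ord_recl/= fpscoefUVXM mulr0 add0r.
by apply: eq_bigr => j _; rewrite fpscoefUVXM.
Qed.

Lemma psdS N K : psd N.+1 K -> psd N K.
Proof.
move=> pK c; have := pK (fun n => if (n < N)%N then c n else 0).
rewrite big_ord_recr/= ltnn [X in _ + X]big1 ?addr0; last by move=> i _; rewrite !mul0r.
rewrite (_ : \sum_(_ < _) _ = \sum_(m < N) \sum_(n < N) c m * c n * K`@_m`@_n)//.
apply: eq_bigr => m _; rewrite big_ord_recr/= ltnn mulr0 mul0r addr0.
by apply: eq_bigr => n _; rewrite !ltn_ord.
Qed.

Lemma psd0 K : psd 0 K.
Proof. by move=> c; rewrite big_ord0. Qed.

End Psd.

(** * The two-parameter family of moment series *)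

Section Family.
Variable R : realFieldType.
Implicit Types (z f g M : fps R) (s t : R).
Local Notation X := (fpsX R).

(** Put w = X M and 1 + 2 z = (1 - 2 w)^(-1/2). Then M = 1 + R(w) becomes the second relation, as
    R(w) = s ((1 + 2 z)^2 - 1) + 2 t z, and the third is 1 - 2 w = (1 + 2 z)^(-2) with denominators
    cleared. No root of a series is taken. *)
Definition zeta_rel s t z M :=
  [/\ z`@_0 = 0, M = 1 + 4 * fpsC s * z * (1 + z) + 2 * fpsC t * z
    & 2 * z * (1 + z) = X * (1 + 2 * z) ^+ 2 * M].

Let stepM s t (e : fps R) : fps R := 1 + 4 * fpsC s * (X * e) * (1 + X * e) + 2 * fpsC t * (X * e).
(** For z = X e, dividing the third relation by 2 X gives e + X e^2 = (1 + 2 X e)^2 M / 2. Solved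
    for the first e, it is a fixed point equation in which e occurs only behind a factor X. *)
Let step s t (e : fps R) : fps R :=
  fpsC 2^-1 * (1 + 2 * (X * e)) ^+ 2 * stepM s t e - X * (e * e).

Lemma half_fpsC : 2 * fpsC (2^-1 : R) = 1.
Proof. by rewrite -[2](rmorph_nat (@fpsC R)) -rmorphM/= mulfV ?pnatr_eq0// rmorph1. Qed.

Lemma step_contractive s t : fps_contractive (step s t).
Proof.
move=> n f g fg; have Xfg := fpseqXM fg.
rewrite /step /stepM !expr2.
by do ?[exact: Xfg | exact: fpseq_refl | apply: fpseqXM; exact: fpseqM |
  apply: fpseqD | apply: fpseqN | apply: fpseqM].
Qed.

Lemma step_rel s t e : step s t e = e <-> zeta_rel s t (X * e) (stepM s t e).
Proof.
have h2 := half_fpsC.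
split=> [E|[_ _ E]].
  split; [by rewrite fpscoefXM | by [] |].
  have -> : 2 * (X * e) * (1 + X * e) = 2 * X * (e + X * (e * e)) by ring.
  rewrite -{1}E /step subrK.
  set m := stepM s t e; set y := (1 + _) ^+ 2.
  by transitivity ((2 * fpsC 2^-1) * (X * y * m)); [ring|rewrite h2 mul1r].
apply: (@fpsX_inj R); rewrite /step mulrBr; apply/eqP; rewrite subr_eq; apply/eqP.
have -> : X * (fpsC 2^-1 * (1 + 2 * (X * e)) ^+ 2 * stepM s t e) =
  fpsC 2^-1 * (X * (1 + 2 * (X * e)) ^+ 2 * stepM s t e) by ring.
rewrite -E; have -> : fpsC 2^-1 * (2 * (X * e) * (1 + X * e)) =
  (2 * fpsC 2^-1) * (X * e + X * (X * (e * e))) by ring.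
by rewrite h2 mul1r.
Qed.

Lemma zeta_rel_ex s t : exists z M, zeta_rel s t z M.
Proof.
have [e /step_rel E] := fps_fixpoint (@step_contractive s t).
by exists (X * e), (stepM s t e).
Qed.

Lemma zeta_relE s t z M : zeta_rel s t z M ->
  exists e, [/\ z = X * e, M = stepM s t e & step s t e = e].
Proof.
move=> H; have [z0 ME _] := H.
have [e eE] := fps_shift z0; exists e.
have ME' : M = stepM s t e by rewrite ME eE.
by split => //; apply/step_rel; rewrite -eE -ME'.
Qed.

Definition hankel M : fps (fps R) := Fps (fun m => Fps (fun n => M`@_(m + n))).

Lemma hankelE M : (fpsU X - fpsV X) * hankel M = fpsU X * fpsU M - fpsV X * fpsV M.
Proof.
apply: fpsP => m; apply: fpsP => n.
rewrite mulrBl fpsUX /fpsV -fpsCM !fpscoefB !fpscoefXM fpscoefCM fpscoefXM fpscoefC.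
case: m => [|m]; [rewrite mulr1n fpscoefXM | rewrite mulr0n].
  by case: n => [|n]; rewrite fpscoef0 ?add0r ?subrr.
by case: n => [|n] /=; [rewrite mulr1n addn0 | rewrite mulr0n addnS subrr subr0].
Qed.

(* Here z and w stand for zeta(u) and zeta(v), M and L for M(u) and M(v), e = 1 / (1 + z),
   d = 1 / (1 + w), and [u * M - v * L] is (u - v) times the Hankel kernel. *)
Lemma kernel_identity (B : comNzRingType)
    (u v s t z w M L e d D h : B) :
    2 * h = 1 -> e * (1 + z) = 1 -> d * (1 + w) = 1 -> D * (1 + z + w) = 1 ->
    M = 1 + 4 * s * z * (1 + z) + 2 * t * z ->
    L = 1 + 4 * s * w * (1 + w) + 2 * t * w ->
    2 * z * (1 + z) = u * (1 + 2 * z) ^+ 2 * M ->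
    2 * w * (1 + w) = v * (1 + 2 * w) ^+ 2 * L ->
  u * M - v * L = (u - v) * (M * L) + u * v * (M * L) *
    ((4 * s * (1 + 2 * z) ^+ 2 * (1 + 2 * w) ^+ 2 +
     t * ((1 + 2 * z) ^+ 2 * e) * ((1 + 2 * w) ^+ 2 * d) *
       (1 + h * (1 + 2 * z) * (1 + 2 * w) * D)) * (u * M - v * L)).
Proof.
move=> h2 e1 d1 D1 ME LE zE wE.
set f := (1 + 2 * z) ^+ 2 * e; set g := (1 + 2 * w) ^+ 2 * d.
(* [G] and [H] are R(p)/p at p = u M and p = v L (see [MG] and [LH]), so [NE] says that the kernel
   is their divided difference. *)
set G := 2 * s * (1 + 2 * z) ^+ 2 + t * f.
set H := 2 * s * (1 + 2 * w) ^+ 2 + t * g.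
have fz : f * (u * M) = 2 * z.
  transitivity (2 * z * (e * (1 + z))); last by rewrite e1 mulr1.
  by rewrite /f; transitivity (e * (u * (1 + 2 * z) ^+ 2 * M)); [ring|rewrite -zE; ring].
have gw : g * (v * L) = 2 * w.
  transitivity (2 * w * (d * (1 + w))); last by rewrite d1 mulr1.
  by rewrite /g; transitivity (d * (v * (1 + 2 * w) ^+ 2 * L)); [ring|rewrite -wE; ring].
have MG : M - 1 = u * M * G.
  rewrite /G mulrDr; transitivity (2 * s * (u * (1 + 2 * z) ^+ 2 * M) + t * (f * (u * M))); last ring.
  by rewrite -zE fz {1}ME; ring.
have LH : L - 1 = v * L * H.
  rewrite /H mulrDr; transitivity (2 * s * (v * (1 + 2 * w) ^+ 2 * L) + t * (g * (v * L))); last ring.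
  by rewrite -wE gw {1}LE; ring.
(* Multiplied by (1 + z)(1 + w)(1 + z + w), both sides equal (z - w)(1 + z + w)(2 (1 + z + w) + (1 +
   2 z)(1 + 2 w)). The inverse D of 1 + z + w enters because z (1 + z)(1 + 2 w)^2 - w (1 + w)(1 + 2
   z)^2 = (z - w)(1 + z + w). *)
have tpart : (2 * z * g - 2 * w * f) * (1 + h * (1 + 2 * z) * (1 + 2 * w) * D) = f - g.
  have cancel x y c c' : c' * c = 1 -> c * x = c * y -> x = y :> B.
    by move=> cc E; rewrite -[x]mul1r -cc -mulrA E mulrA cc mul1r.
  have f1 : (1 + z) * f = (1 + 2 * z) ^+ 2 by rewrite /f mulrCA [_ * e]mulrC e1 mulr1.
  have g1 : (1 + w) * g = (1 + 2 * w) ^+ 2 by rewrite /g mulrCA [_ * d]mulrC d1 mulr1.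
  apply: (cancel _ _ _ _ e1); apply: (cancel _ _ _ _ d1); apply: (cancel _ _ _ _ D1).
  transitivity ((2 * z * (1 + z) * ((1 + w) * g) - 2 * w * (1 + w) * ((1 + z) * f)) *
    ((1 + z + w) + h * (1 + 2 * z) * (1 + 2 * w) * (D * (1 + z + w)))); first ring.
  transitivity ((1 + z + w) * ((1 + w) * ((1 + z) * f) - (1 + z) * ((1 + w) * g))); last ring.
  rewrite f1 g1 D1 mulr1.
  transitivity ((z * (1 + z) * (1 + 2 * w) ^+ 2 - w * (1 + w) * (1 + 2 * z) ^+ 2) *
   (2 * (1 + z + w) + (2 * h) * (1 + 2 * z) * (1 + 2 * w))); first ring.
  by rewrite h2; ring.
have NE : (4 * s * (1 + 2 * z) ^+ 2 * (1 + 2 * w) ^+ 2 +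
     t * f * g * (1 + h * (1 + 2 * z) * (1 + 2 * w) * D)) * (u * M - v * L) = G - H.
  transitivity (4 * s * ((1 + 2 * w) ^+ 2 * (u * (1 + 2 * z) ^+ 2 * M) -
      (1 + 2 * z) ^+ 2 * (v * (1 + 2 * w) ^+ 2 * L)) +
    t * (((f * (u * M)) * g - (g * (v * L)) * f) * (1 + h * (1 + 2 * z) * (1 + 2 * w) * D))); first ring.
  by rewrite -zE -wE fz gw tpart /G /H; ring.
rewrite NE; transitivity ((u - v) * (M * L) + v * L * (u * M * G) - u * M * (v * L * H)); last ring.
by rewrite -MG -LH; ring.
Qed.

Lemma psd_hankel s t z M : 0 <= s -> 0 <= t -> zeta_rel s t z M ->
  forall N, psd N (hankel M).
Proof.
move=> s0 t0 [z0 ME zE].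
have [e e1] : exists e, (1 + z) * e = 1.
  by apply: fps_inv; rewrite fpscoefD z0 addr0.
have [q qE] : exists q, z * e = X * q.
  by apply: fps_shift; rewrite fpscoefM0 z0 mul0r.
(* From 1 + z + w = (1 + z)(1 + w) - z w, the inverse of 1 + z + w is e(u) e(v) T, where T is the
   geometric series of the rank-one kernel (z e)(u) (z e)(v). *)
have [T T1] : exists T, (1 - fpsU (z * e) * fpsV (z * e)) * T = 1.
  apply: fps_inv.
  have U0 : (fpsU (z * e))`@_0 = 0.
    by change (fpsC (z * e)`@_0 = 0); rewrite fpscoefM0 z0 mul0r rmorph0.
  by rewrite fpscoefB fpscoefM0 U0 mul0r subr0.
have TE : T = 1 + fpsU X * fpsV X * (fpsU q * fpsV q * T).
  have -> : fpsU X * fpsV X * (fpsU q * fpsV q * T) = fpsU (X * q) * fpsV (X * q) * T.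
    by rewrite !rmorphM/=; ring.
  by rewrite -qE; apply/eqP; rewrite -subr_eq -[X in _ == X]T1; apply/eqP; ring.
(* As z e is divisible by X, T K is K plus u v times a congruence of T K itself, so size N yields
   size N + 1. *)
have psdT N K : psd N K -> psd N (T * K).
  elim: N K => [|N IH] K pK; first exact: psd0.
  have -> : T * K = K + fpsU X * fpsV X * (fpsU q * fpsV q * (T * K)).
    by rewrite {1}TE; ring.
  apply: psdD => //; apply: psd_shift; apply: psd_congr; apply: IH; exact: psdS.
set D := fpsU e * fpsV e * T.
set Z := 1 + 2 * z.
have D1 : D * (1 + fpsU z + fpsV z) = 1.
  rewrite -[RHS]T1 /D; have eU : (1 + fpsU z) * fpsU e = 1.
    by rewrite -[1 in LHS](rmorph1 (@fpsU R)) -rmorphD -rmorphM/= e1 rmorph1.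
  have eV : (1 + fpsV z) * fpsV e = 1.
    by rewrite -[1 in LHS](rmorph1 (@fpsV R)) -rmorphD -rmorphM/= e1 rmorph1.
  rewrite !rmorphM/=.
  transitivity ((((1 + fpsU z) * fpsU e) * ((1 + fpsV z) * fpsV e) -
    fpsU z * fpsU e * (fpsV z * fpsV e)) * T); first by ring.
  by rewrite eU eV; ring.
(* [NA K] is N times K, bracketed so that every factor is a nonnegative scalar, a congruence or
   T. *)
pose NA K := 4 * fpsV (fpsC s) * (fpsU (Z ^+ 2) * fpsV (Z ^+ 2)  * K) +
   fpsV (fpsC t) * (fpsU (Z ^+ 2 * e) * fpsV (Z ^+ 2 * e) *
     (K + fpsV (fpsC 2^-1) * (fpsU (Z * e) * fpsV (Z * e) * (T * K)))).
have HE : hankel M = fpsU M * fpsV M + fpsU X * fpsV X * (fpsU M * fpsV M * NA (hankel M)).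
  (* Multiplied by u - v, the equation is [kernel_identity], since [hankelE] evaluates (u - v) times
     the Hankel kernel. *)
  apply: fpsUVX_inj; rewrite mulrDr; set uv := _ - _.
  have -> : uv * (fpsU X * fpsV X * (fpsU M * fpsV M * NA (hankel M))) =
     fpsU X * fpsV X * (fpsU M * fpsV M) * NA (uv * hankel M).
    by rewrite /NA; ring.
  rewrite {1}hankelE /uv hankelE.
  have := @kernel_identity (fps (fps R)) (fpsU X) (fpsV X) (fpsV (fpsC s)) (fpsV (fpsC t))
    (fpsU z) (fpsV z) (fpsU M) (fpsV M) (fpsU e) (fpsV e) D (fpsV (fpsC 2^-1)).
  have n2U : fpsU (2 : fps R) = 2 by rewrite rmorph_nat.
  have n2V : fpsV (2 : fps R) = 2 by rewrite rmorph_nat.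
  have n4U : fpsU (4 : fps R) = 4 by rewrite rmorph_nat.
  have n4V : fpsV (4 : fps R) = 4 by rewrite rmorph_nat.
  move=> kid; rewrite [LHS]kid// {kid}.
  - rewrite /NA /Z /D !(n2U, n2V, rmorphM, rmorphD, rmorphXn, rmorph1)/=; ring.
  - by rewrite -n2V -rmorphM/= half_fpsC rmorph1.
  - by rewrite -[1 in LHS](rmorph1 (@fpsU R)) -rmorphD -rmorphM/= mulrC e1 rmorph1.
  - by rewrite -[1 in LHS](rmorph1 (@fpsV R)) -rmorphD -rmorphM/= mulrC e1 rmorph1.
  - by rewrite {1}ME -!fpsUC !(n2U, n4U, rmorphM, rmorphD, rmorphXn, rmorph1)/=.
  - by rewrite {1}ME !(n2V, n4V, rmorphM, rmorphD, rmorphXn, rmorph1)/=.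
  - have := congr1 (@fpsU R) zE.
    by rewrite !(n2U, rmorphM, rmorphD, rmorphXn, rmorph1)/=.
  - have := congr1 (@fpsV R) zE.
    by rewrite !(n2V, rmorphM, rmorphD, rmorphXn, rmorph1)/=.
elim=> [|N IH]; first exact: psd0.
rewrite HE; apply: psdD; first exact: psd_rank1.
apply: psd_shift; apply: psd_congr; rewrite /NA.
apply: psdD.
  have -> : 4 * fpsV (fpsC s) = fpsV (fpsC (4 * s)).
    by rewrite [RHS](congr1 (@fpsV R) (rmorphM (@fpsC R) _ _)) rmorphM/= !rmorph_nat.
  by apply: psdZ; [rewrite mulr_ge0| exact: psd_congr].
apply: psdZ => //; apply: psd_congr; apply: psdD => //.
by apply: psdZ; [rewrite invr_ge0 | apply: psd_congr; exact: psdT].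
Qed.

End Family.

(** * Geometric bounds and evaluation *)

Lemma sum_triangle (V : nmodType) (F : nat -> nat -> V) N :
  \sum_(n < N) \sum_(i < n.+1) F i (n - i)%N =
  \sum_(i < N) \sum_(j < N | (i + j < N)%N) F i j.
Proof.
transitivity (\sum_(n < N) \sum_(i < N | (i <= n)%N) F i (n - i)%N).
  apply: eq_bigr => n _.
  by rewrite (big_ord_widen_cond N xpredT (fun i => F i (n - i)%N)).
rewrite (exchange_big_dep xpredT)//=; apply: eq_bigr => i _.
rewrite -(big_geq_mkord _ N (fun=> true) (fun n => F i (n - i)%N)).
rewrite -{1}[nat_of_ord i]add0n big_addn big_mkord.
rewrite (big_ord_widen_cond N xpredT (fun n => F i (n + i - i)%N)) ?leq_subr//=.
by apply: eq_big => [j|j _]; [rewrite ltn_subRL | rewrite addnK].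
Qed.

Section Norm.
Variable R : realFieldType.
Implicit Types (f g : fps R) (r : R).

(** A weighted l1 norm of the truncation at degree N. It is submultiplicative for every N, and a
    factor X brings a factor r while N grows by one, so that a fixed point equation bounds it by
    induction on N, uniformly. *)
Definition fps_norm r N f := \sum_(i < N) `|f`@_i| * r ^+ i.

Variable r : R.
Hypothesis r0 : 0 <= r.
Local Notation nrm := (fps_norm r).

Lemma fps_norm_ge0 N f : 0 <= nrm N f.
Proof. by apply: sumr_ge0 => i _; rewrite mulr_ge0 ?exprn_ge0. Qed.

Lemma fps_normD N f g : nrm N (f + g) <= nrm N f + nrm N g.
Proof.
rewrite -big_split/=; apply: ler_sum => i _.
by rewrite -mulrDl ler_wpM2r ?exprn_ge0// ler_normD.
Qed.

Lemma fps_normN N f : nrm N (- f) = nrm N f.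
Proof. by apply: eq_bigr => i _; rewrite fpscoefN normrN. Qed.

Lemma fps_normM N f g : nrm N (f * g) <= nrm N f * nrm N g.
Proof.
pose F i j := (`|f`@_i| * r ^+ i) * (`|g`@_j| * r ^+ j).
have F0 i j : 0 <= F i j by rewrite /F !mulr_ge0 ?exprn_ge0.
apply: (@le_trans _ _ (\sum_(n < N) \sum_(i < n.+1) F i (n - i)%N)).
  apply: ler_sum => n _; rewrite fpscoefM.
  apply: (le_trans (ler_wpM2r _ (ler_norm_sum _ _ _))); rewrite ?exprn_ge0//.
  rewrite mulr_suml; apply: ler_sum => i _.
  rewrite normrM /F le_eqVlt; apply/orP; left; apply/eqP.
  have -> : r ^+ n = r ^+ i * r ^+ (n - i) by rewrite -exprD subnKC// -ltnS.
  by ring.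
rewrite sum_triangle /fps_norm mulr_suml; apply: ler_sum => i _.
rewrite mulr_sumr [leRHS](bigID (fun j : 'I_N => (i + j < N)%N))/= lerDl.
by apply: sumr_ge0 => j _; exact: F0.
Qed.

Lemma fps_normXM N f : nrm N.+1 (fpsX R * f) = r * nrm N f.
Proof.
rewrite /fps_norm big_ord_recl fpscoefXM normr0 mul0r add0r mulr_sumr.
by apply: eq_bigr => i _; rewrite fpscoefXM exprS; ring.
Qed.

Lemma fps_normC N a : nrm N (fpsC a) <= `|a|.
Proof.
case: N => [|N]; first by rewrite /fps_norm big_ord0.
rewrite /fps_norm big_ord_recl /= mulr1n expr0 mulr1 big1 ?addr0// => i _.
by rewrite mulr0n normr0 mul0r.
Qed.

Lemma fps_normW N f : nrm N f <= nrm N.+1 f.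
Proof. by rewrite /fps_norm big_ord_recr lerDl mulr_ge0 ?exprn_ge0. Qed.

Lemma fps_norm_coef N f n : (n < N)%N -> `|f`@_n| * r ^+ n <= nrm N f.
Proof.
move=> nN; rewrite /fps_norm (bigD1 (Ordinal nN))//= lerDl.
by apply: sumr_ge0 => i _; rewrite mulr_ge0 ?exprn_ge0.
Qed.

Definition fps_bounded f := exists B, forall N, nrm N f <= B.

Lemma fps_boundedD f g : fps_bounded f -> fps_bounded g -> fps_bounded (f + g).
Proof.
by move=> [A hA] [B hB]; exists (A + B) => N; apply: (le_trans (fps_normD _ _ _)); apply: lerD.
Qed.
Lemma fps_boundedM f g : fps_bounded f -> fps_bounded g -> fps_bounded (f * g).
Proof.
move=> [A hA] [B hB]; exists (A * B) => N; apply: (le_trans (fps_normM _ _ _)).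
by apply: ler_pM; rewrite ?fps_norm_ge0.
Qed.
Lemma fps_boundedC a : fps_bounded (fpsC a).
Proof. by exists `|a| => N; exact: fps_normC. Qed.
Lemma fps_boundedX : fps_bounded (fpsX R).
Proof.
have [B hB] := fps_boundedC 1; exists (r * B) => N; apply: (le_trans (fps_normW _ _)).
by rewrite -[fpsX R]mulr1 fps_normXM -fpsC1 ler_wpM2l.
Qed.

End Norm.

Section ZetaBounded.
Variable R : realFieldType.

Lemma fps_normD_le (r : R) N (f g : fps R) a b : 0 <= r ->
  fps_norm r N f <= a -> fps_norm r N g <= b -> fps_norm r N (f + g) <= a + b.
Proof. by move=> r0 fa gb; apply: (le_trans (fps_normD r0 _ _ _)); exact: lerD. Qed.

Lemma fps_normM_le (r : R) N (f g : fps R) a b : 0 <= r ->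
  fps_norm r N f <= a -> fps_norm r N g <= b -> fps_norm r N (f * g) <= a * b.
Proof.
move=> r0 fa gb; apply: (le_trans (fps_normM r0 _ _ _)).
by apply: ler_pM; rewrite ?fps_norm_ge0.
Qed.

Lemma fps_norm_nat (r : R) N n : 0 <= r -> fps_norm r N (n%:R : fps R) <= n%:R.
Proof.
move=> r0; rewrite -(rmorph_nat (@fpsC R)); apply: (le_trans (fps_normC _ _ _)) => //.
by rewrite normr_nat.
Qed.

Lemma zeta_rel_bounded (s t : R) (z M : fps R) : 0 <= s -> 0 <= t -> zeta_rel s t z M ->
  exists r, [/\ 0 < r, fps_bounded r z & fps_bounded r M].
Proof.
move=> s0 t0 H.
have [e [zE ME eE]] := zeta_relE H.
(* The constants make the bound B on e reproduce itself. With r B = 1/2, X e has norm at most 1/2, M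
   at most 1 + 3 s + t, and [step] at most 2 (1 + 3 s + t) + r B^2 = B/2 + B/2. *)
pose B : R := 4 * (1 + 3 * s + t).
have B0 : 0 < B by rewrite /B; nra.
pose r := (2 * B)^-1.
have r0 : 0 < r by rewrite invr_gt0 mulr_gt0.
have r0' := ltW r0.
have rB : r * B = 2^-1 by rewrite /r invfM -mulrA mulVf ?mulr1// gt_eqF.
have eB N : fps_norm r N e <= B.
  elim: N => [|N IH]; first by rewrite /fps_norm big_ord0 ltW.
  have zB : fps_norm r N.+1 (fpsX R * e) <= 2^-1.
    by rewrite fps_normXM -rB ler_wpM2l.
  have nn k : fps_norm r N.+1 (k%:R : fps R) <= k%:R by exact: fps_norm_nat.
  have nC c : 0 <= c -> fps_norm r N.+1 (fpsC c) <= c.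
    by move=> c0; apply: (le_trans (fps_normC _ _ _)); rewrite ?ger0_norm.
  have nz : fps_norm r N.+1 (1 + 2 * (fpsX R * e)) <= 1 + 2 * 2^-1.
    by apply: fps_normD_le => //; [exact: (nn 1%N) | exact: fps_normM_le].
  rewrite -eE /= expr2.
  have : fps_norm r N.+1 (fpsC 2^-1 * ((1 + 2 * (fpsX R * e)) * (1 + 2 * (fpsX R * e))) *
     (1 + 4 * fpsC s * (fpsX R * e) * (1 + fpsX R * e) + 2 * fpsC t * (fpsX R * e)) -
     fpsX R * (e * e)) <=
     2^-1 * ((1 + 2 * 2^-1) * (1 + 2 * 2^-1)) * (1 + 4 * s * 2^-1 * (1 + 2^-1) + 2 * t * 2^-1) + r * (B * B).
    apply: fps_normD_le => //; last first.
      by rewrite fps_normN fps_normXM ler_wpM2l//; apply: fps_normM_le.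
    have nh : fps_norm r N.+1 (fpsC 2^-1) <= 2^-1 by apply: nC; lra.
    have n2 : fps_norm r N.+1 (2 : fps R) <= 2 := nn 2%N.
    have n4 : fps_norm r N.+1 (4 : fps R) <= 4 := nn 4%N.
    have n1 : fps_norm r N.+1 (1 : fps R) <= 1 := nn 1%N.
    have ns := nC _ s0; have nt := nC _ t0.
    by do ?[exact: nh | exact: n1 | exact: n2 | exact: n4 | exact: ns | exact: nt | exact: nz
      | exact: zB | apply: fps_normM_le => // | apply: fps_normD_le => //].
  move/le_trans; apply.
  by rewrite [r * (B * B)]mulrA rB /B; lra.
have zb : fps_bounded r z.
  rewrite zE; apply: fps_boundedM => //; first exact: fps_boundedX.
  by exists B.
exists r; split => //.
have [_ -> _] := H.
have n1 k : fps_bounded r (k%:R : fps R) by exists k%:R => N; exact: fps_norm_nat.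
by do ![apply: fps_boundedD | apply: fps_boundedM | exact: zb
  | exact: fps_boundedC | exact: (n1 1%N) | exact: n1].
Qed.
End ZetaBounded.

Section Eval.
Variable R : realType.
Implicit Types (f g : fps R) (r x a b : R).

Definition fps_has_sum x f a := series (fun i => f`@_i * x ^+ i) @ \oo --> a.

Lemma fps_has_sumE x f : series (fun i => f`@_i * x ^+ i) = fun n => \sum_(i < n) f`@_i * x ^+ i.
Proof. by rewrite seriesEord. Qed.

Lemma norm_partial_sum r x f N : `|x| <= r ->
  `|\sum_(i < N) f`@_i * x ^+ i| <= fps_norm r N f.
Proof.
move=> xr; apply: (le_trans (ler_norm_sum _ _ _)); apply: ler_sum => i _.
by rewrite normrM ler_wpM2l// normrX lerXn2r ?nnegrE// (le_trans _ xr).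
Qed.

Lemma fps_bounded_has_sum r x f : `|x| <= r -> fps_bounded r f ->
  exists a, fps_has_sum x f a.
Proof.
move=> xr [B hB]; apply/cvg_ex; apply: normed_cvg.
apply: nondecreasing_is_cvgn.
  by apply: nondecreasing_series => n _ _; exact: normr_ge0.
exists B => _ [N _ <-]; rewrite /normed_series_of seriesEord; apply: le_trans (hB N).
apply: ler_sum => i _.
by rewrite [leLHS]normrM ler_wpM2l// normrX lerXn2r ?nnegrE// (le_trans _ xr).
Qed.

Lemma fps_has_sum_uniq x f a b : fps_has_sum x f a -> fps_has_sum x f b -> a = b.
Proof. by move=> fa fb; apply: (cvg_unique _ fa fb). Qed.

Lemma fps_has_sumD x f g a b : fps_has_sum x f a -> fps_has_sum x g b ->
  fps_has_sum x (f + g) (a + b).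
Proof.
rewrite /fps_has_sum !fps_has_sumE => fa gb.
rewrite (_ : (fun n => _) = (fun n => \sum_(i < n) f`@_i * x ^+ i) \+ (fun n => \sum_(i < n) g`@_i * x ^+ i)).
  exact: cvgD.
by apply/funext => n /=; rewrite -big_split/=; apply: eq_bigr => i _; rewrite mulrDl.
Qed.

Lemma fps_has_sumC x a : fps_has_sum x (fpsC a) a.
Proof.
rewrite /fps_has_sum fps_has_sumE; apply: cvg_near_cst.
exists 1%N => // -[|n]// _; rewrite /= big_ord_recl /= mulr1n mulr1 big1 ?addr0// => i _.
by rewrite mulr0n mul0r.
Qed.

Lemma fps_has_sumX x : fps_has_sum x (fpsX R) x.
Proof.
rewrite /fps_has_sum fps_has_sumE; apply: cvg_near_cst.
exists 2%N => // -[|[|n]]// _; rewrite /= 2!big_ord_recl /= mul0r add0r mul1r expr1.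
by rewrite big1 ?addr0// => i _; rewrite mul0r.
Qed.

(** The product of the partial sums exceeds the partial sum of the product by [d n], the terms with
    i + j >= n. Going down from radius r to |x| gains at least the factor (|x| / r)^n there. *)
Lemma fps_has_sumM r x f g a b : `|x| < r -> fps_bounded r f -> fps_bounded r g ->
  fps_has_sum x f a -> fps_has_sum x g b -> fps_has_sum x (f * g) (a * b).
Proof.
move=> xr [A hA] [B hB]; rewrite /fps_has_sum !fps_has_sumE => fa gb.
have r0 : 0 < r by exact: le_lt_trans xr.
pose F i j := (f`@_i * x ^+ i) * (g`@_j * x ^+ j).
pose d n := \sum_(i < n) \sum_(j < n | ~~ (i + j < n)%N) F i j.
have pE n : \sum_(i < n) (f * g)`@_i * x ^+ i =
   (\sum_(i < n) f`@_i * x ^+ i) * (\sum_(i < n) g`@_i * x ^+ i) - d n.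
  apply/eqP; rewrite eq_sym subr_eq; apply/eqP.
  transitivity (\sum_(i < n) \sum_(j < n) F i j).
    by rewrite mulr_suml; apply: eq_bigr => i _; rewrite mulr_sumr.
  have -> : \sum_(i < n) (f * g)`@_i * x ^+ i = \sum_(m < n) \sum_(i < m.+1) F i (m - i)%N.
    apply: eq_bigr => m _; rewrite fpscoefM mulr_suml; apply: eq_bigr => i _.
    have -> : x ^+ m = x ^+ i * x ^+ (m - i) by rewrite -exprD subnKC// -ltnS.
    by rewrite /F; ring.
  rewrite sum_triangle -big_split/=; apply: eq_bigr => i _.
  by rewrite (bigID (fun j : 'I_n => (i + j < n)%N)).
pose q := `|x| / r.
have q0 : 0 <= q by rewrite divr_ge0// ltW.
have q1 : q < 1 by rewrite /q ltr_pdivrMr// mul1r.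
have xq : `|x| = q * r by rewrite /q divfK ?gt_eqF.
clearbody q.
have dq n : `|d n| <= q ^+ n * (A * B).
  apply: (@le_trans _ _ (q ^+ n * (fps_norm r n f * fps_norm r n g))); last first.
    rewrite ler_wpM2l ?exprn_ge0//; apply: ler_pM => //; exact: fps_norm_ge0 (ltW r0) _ _.
  apply: (le_trans (ler_norm_sum _ _ _)).
  rewrite /fps_norm mulr_suml mulr_sumr; apply: ler_sum => i _.
  apply: (le_trans (ler_norm_sum _ _ _)).
  rewrite !mulr_sumr [leRHS](bigID (fun j : 'I_n => ~~ (i + j < n)%N))/=.
  rewrite -[leLHS]addr0; apply: lerD; last first.
    by apply: sumr_ge0 => j _; rewrite !mulr_ge0 ?exprn_ge0// ltW.
  apply: ler_sum => j; rewrite -leqNgt => nij.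
  have -> : `|F i j| = q ^+ (i + j) * (`|f`@_i| * r ^+ i * (`|g`@_j| * r ^+ j)).
    by rewrite /F !normrM !normrX xq !exprMn exprD; ring.
  apply: ler_wpM2r; first by rewrite !mulr_ge0 ?exprn_ge0// ltW.
  by apply: ler_wiXn2l => //; exact: ltW.
have d0 : d @ \oo --> 0.
  apply/norm_cvg0P; apply: (@squeeze_cvgr _ _ _ _ (fun=> 0) (fun n => q ^+ n * (A * B))).
  - by near=> n; rewrite normr_ge0 dq.
  - exact: cvg_cst.
  - rewrite -[X in _ --> X](mul0r (A * B)); apply: cvgM; last exact: cvg_cst.
    by apply: cvg_expr; rewrite ger0_norm.
rewrite (_ : (fun n => _) = fun n => (\sum_(i < n) f`@_i * x ^+ i) * (\sum_(i < n) g`@_i * x ^+ i) - d n).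
  by rewrite -[a * b]subr0; apply: cvgB => //; exact: cvgM.
by apply/funext.
Unshelve. all: by end_near. Qed.

Lemma fps_has_sum_le r B x f a : `|x| <= r -> (forall N, fps_norm r N f <= B) ->
  fps_has_sum x f a -> `|a| <= B.
Proof.
rewrite /fps_has_sum fps_has_sumE => xr hB fa.
apply: (cvgr_to_le (cvg_norm fa)); near=> n.
exact: le_trans (norm_partial_sum _ _ xr) (hB n).
Unshelve. all: by end_near. Qed.

End Eval.

(** * From moment series to R-transforms and compact support *)

Section Rtransform.
Variable R : realType.
Implicit Types (mu : probability R R) (z M : fps R) (s t : R).

(** The first summand is 2 s w / (1 - 2 w), which for s > 0 is the R-transform of the dilation by 2
    of the Marchenko-Pastur law of parameter s. *)
Definition Rst s t (w : R) := s * ((1 - 2 * w)^-1 - 1) + t * ((Num.sqrt (1 - 2 * w))^-1 - 1).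

Definition has_moments mu M := forall n, moment mu n = (M`@_n)%:E.

Lemma zeta_rel_Rtransform mu s t z M : 0 <= s -> 0 <= t -> zeta_rel s t z M ->
  has_moments mu M -> is_Rtransform mu (Rst s t).
Proof.
move=> s0 t0 zM hM; have [r [r0 bz bM]] := zeta_rel_bounded s0 t0 zM.
have [e [zE _ _]] := zeta_relE zM.
have [z0 ME zeq] := zM.
have [B hB] := bz.
have eB N : fps_norm r N e <= B / r.
  by rewrite ler_pdivlMr// mulrC -fps_normXM -zE.
have be : fps_bounded r e by exists (B / r).
have B0 : 0 <= B by apply: le_trans (hB 0%N); exact: fps_norm_ge0 (ltW r0) _ _.
have bX : fps_bounded r (fpsX R) := fps_boundedX (ltW r0).
have bC a : fps_bounded r (fpsC a) by exact: fps_boundedC.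
(* This radius lies below r and makes the value c of zeta at x at most 1/4 in absolute value. Hence
   1 + 2 c > 0, and the square root of 1 - 2 x m = (1 + 2 c)^(-2) is (1 + 2 c)^(-1). *)
exists (r / (4 * (B + 1))); first by rewrite divr_gt0// mulr_gt0// ltr_wpDl.
move=> x; rewrite ltr_pdivlMr ?mulr_gt0 ?ltr_wpDl// => xr.
have xr' : `|x| < r by apply: le_lt_trans xr; rewrite ler_peMr//; lra.
have mE : Mterm mu x = fun i => M`@_i * x ^+ i.
  by apply/funext => i; rewrite /Mterm hM.
have [m mM] := fps_bounded_has_sum (ltW xr') bM.
have [y ye] := fps_bounded_has_sum (ltW xr') be.
have yB : `|y| <= B / r := fps_has_sum_le (ltW xr') eB ye.
have cz : fps_has_sum x z (x * y).
  by rewrite zE; apply: (fps_has_sumM xr') => //; exact: fps_has_sumX.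
rewrite /Mseries mE; split; first by apply/cvg_ex; exists m.
rewrite (cvg_lim _ mM)//.
set c := x * y in cz.
have c1 : `|c| <= 4^-1.
  rewrite /c normrM; apply: (@le_trans _ _ (`|x| * (B / r))); first by rewrite ler_wpM2l.
  rewrite mulrA ler_pdivrMr//; have := normr_ge0 x; move: xr; lra.
have c2 : 0 < 1 + 2 * c by move: c1; rewrite ler_norml; lra.
(* Closure of [ev] under sums and products carries the relations of [zeta_rel] from series over to
   their values at x. *)
pose ev f l := fps_bounded r f /\ fps_has_sum x f l.
have evz : ev z c by [].
have evM : ev M m by [].
have evX : ev (fpsX R) x by split => //; exact: fps_has_sumX.
have evC l : ev (fpsC l) l by split; [exact: bC | exact: fps_has_sumC].
have evn k : ev k%:R k%:R by rewrite -(rmorph_nat (@fpsC R)); exact: evC.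
have ev1 : ev 1 1 := evn 1%N.
have evD f g k l : ev f k -> ev g l -> ev (f + g) (k + l).
  by move=> [bf sf] [bg sg]; split; [exact: fps_boundedD (ltW r0) _ _ bf bg | exact: fps_has_sumD].
have evMul f g k l : ev f k -> ev g l -> ev (f * g) (k * l).
  by move=> [bf sf] [bg sg]; split; [exact: fps_boundedM (ltW r0) _ _ bf bg | exact: fps_has_sumM xr' _ _ _ _].
have m1 : m = 1 + 4 * s * c * (1 + c) + 2 * t * c.
  apply: (fps_has_sum_uniq mM).
  suff [] : ev M (1 + 4 * s * c * (1 + c) + 2 * t * c) by [].
  by rewrite ME; do 10?[exact: evz | exact: ev1 | exact: evn | exact: evC | apply: (evD) | apply: (evMul)].
have m2 : 2 * c * (1 + c) = x * (1 + 2 * c) ^+ 2 * m.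
  have [_ l2] : ev (2 * z * (1 + z)) (2 * c * (1 + c)).
    by do 10?[exact: evz | exact: ev1 | exact: evn | apply: (evD) | apply: (evMul)].
  have [_ r2] : ev (fpsX R * (1 + 2 * z) ^+ 2 * M) (x * (1 + 2 * c) ^+ 2 * m).
    rewrite !expr2.
    by do 10?[exact: evX | exact: evM | exact: evz | exact: ev1 | exact: evn | apply: (evD) | apply: (evMul)].
  by apply: fps_has_sum_uniq l2 _; rewrite zeq.
have w1 : 1 - 2 * (x * m) = (1 + 2 * c) ^- 2.
  apply: (mulIf (lt0r_neq0 (exprn_gt0 2 c2))).
  rewrite mulVf ?expf_neq0 ?gt_eqF//.
  transitivity ((1 + 2 * c) ^+ 2 - 2 * (x * (1 + 2 * c) ^+ 2 * m)); first by ring.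
  by rewrite -m2; ring.
rewrite /Rst w1 -exprVn sqrtr_sqr ger0_norm ?invr_ge0 1?ltW// exprVn !invrK m1.
by ring.
Qed.

(** Markov's inequality for t^(2n) gives the set |t| > 2 K a mass of at most A / 4^n for every n. *)
Lemma moment_bound_compact mu A K : 0 < K ->
  (forall n, moment mu (n.*2) <= (A * K ^+ n.*2)%:E)%E -> compactly_supported mu.
Proof.
move=> K0 hA; exists (2 * K); set D := [set x | _].
have mD : measurable D.
  rewrite (_ : D = @Num.norm R R @^-1` `]2 * K, +oo[%classic).
    by rewrite -[X in measurable X]setTI; exact: measurable_realfun.normr_measurable.
  by apply/seteqP; split => x /=; rewrite in_itv/= andbT.
have bound n : (mu D <= (A * (4^-1) ^+ n)%:E)%E.
  rewrite -(@lee_pmul2l _ ((2 * K) ^+ n.*2)%:E) ?fin_numE// ?lte_fin ?exprn_gt0 ?mulr_gt0//.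
  rewrite -EFinM (_ : (2 * K) ^+ _ * _ = A * K ^+ n.*2); last first.
    have e4 : (2 * K) ^+ n.*2 = 4 ^+ n * K ^+ n.*2 by rewrite exprMn -mul2n !exprM; congr (_ ^+ n * _); ring.
    have f4 : 4 ^+ n * 4^-1 ^+ n = 1 :> R by rewrite -exprMn mulfV ?expr1n.
    by rewrite e4; transitivity ((4 ^+ n * 4^-1 ^+ n) * (A * K ^+ n.*2)); [ring | rewrite f4 mul1r].
  apply: le_trans (hA n); rewrite /moment -integral_cst//.
  apply: (@le_trans _ _ (\int[mu]_(t in D) (t ^+ n.*2)%:E)%E); last first.
    apply: ge0_subset_integral => //.
      by apply/measurable_EFinP; apply: measurable_funX.
    by move=> x _; rewrite lee_fin -mul2n exprM exprn_ge0 ?sqr_ge0.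
  apply: ge0_le_integral => //.
  - by move=> x _; rewrite lee_fin exprn_ge0// mulr_ge0// ltW.
  - by apply/measurable_EFinP; apply: measurable_funX.
  - move=> x /= Dx; rewrite lee_fin -mul2n !exprM lerXn2r ?nnegrE ?sqr_ge0//.
    by rewrite -(real_normK (num_real x)) lerXn2r ?nnegrE// ?mulr_ge0 ?ltW.
have fD : mu D \is a fin_num by exact: fin_num_measure.
apply/eqP; rewrite eq_le measure_ge0 andbT -(fineK fD) lee_fin.
have h : (fun n => A * 4^-1 ^+ n : R) @ \oo --> (0:R).
  rewrite -[X in _ --> X](mulr0 A); apply: cvgM; first exact: cvg_cst.
  by apply: cvg_expr; rewrite ger0_norm ?invr_ge0// invf_lt1// ltr1n.
apply: (cvgr_to_ge h); near=> n.
by rewrite -lee_fin fineK.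
Unshelve. all: by end_near. Qed.

Lemma zeta_rel_compact mu s t z M : 0 <= s -> 0 <= t -> zeta_rel s t z M ->
  has_moments mu M -> compactly_supported mu.
Proof.
move=> s0 t0 zM hM; have [r [r0 _ [B hB]]] := zeta_rel_bounded s0 t0 zM.
apply: (@moment_bound_compact mu B r^-1); first by rewrite invr_gt0.
move=> n; rewrite hM lee_fin exprVn ler_pdivlMr ?exprn_gt0//.
apply: le_trans (hB (n.*2).+1); apply: le_trans (fps_norm_coef (ltW r0) _ (ltnSn _)).
by rewrite ler_wpM2r ?exprn_ge0 ?ler_norm// ltW.
Qed.

End Rtransform.

(** * The bounded Hamburger moment problem *)

Section PositiveFunctional.
Variable R : realType.
Variable L : {scalar {poly R}}.
Hypothesis Lpos : forall p, 0 <= L (p * p).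
Variables (A K : R).
Hypothesis K0 : 0 < K.
Hypothesis Lbound : forall n, `|L 'X^n| <= A * K ^+ n.

Lemma scalar_polyCM c p : L (c%:P * p) = c * L p.
Proof. by rewrite mul_polyC linearZ. Qed.

Lemma scalar_XnM_bound p : exists B, forall n, L ('X^n * p) <= B * K ^+ n.
Proof.
exists (\sum_(i < size p) `|p`_i| * (A * K ^+ i)) => n.
rewrite -{1}[p]coefK poly_def mulr_sumr linear_sum mulr_suml; apply: ler_sum => i _.
rewrite -scalerAr linearZ -exprD; apply: (le_trans (ler_norm _)).
rewrite normrM -mulrA ler_wpM2l//; apply: (le_trans (Lbound _)).
by rewrite exprD -mulrA [K ^+ n * _]mulrC.
Qed.

(* The sequence c m = L (X^(2m) p^2) satisfies the convexity inequality [rr], so it would grow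
   at least like (4 K^2)^m if c 1 exceeded 4 K^2 * c 0. *)
Lemma scalar_X2M_le p : L ('X^2 * (p * p)) <= (2 * K) ^+ 2 * L (p * p).
Proof.
rewrite leNgt; apply/negP => lt0.
pose c m := L ('X^(m.*2) * (p * p)).
have [l lE] : exists l, l = (2 * K) ^+ 2 by exists ((2 * K) ^+ 2).
have l0 : 0 <= l by rewrite lE sqr_ge0.
rewrite -lE in lt0.
have c0 m : 0 <= c m.
  rewrite /c.
  have -> : 'X^(m.*2) * (p * p) = ('X^m * p) * ('X^m * p) by rewrite -addnn exprD; ring.
  exact: Lpos.
pose r m := c m.+1 - l * c m.
have rr m : l * r m <= r m.+1.
  have := Lpos (('X^2 - l%:P) * 'X^m * p).
  rewrite (_ : _ * _ = 'X^(m.+2.*2) * (p * p) - (l + l)%:P * ('X^(m.+1.*2) * (p * p))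
    + (l * l)%:P * ('X^(m.*2) * (p * p))); last first.
    by rewrite polyCM polyCD !doubleS !exprS -addnn exprD; ring.
  by rewrite linearD linearB !scalar_polyCM -/(c m.+2) -/(c m.+1) -/(c m) /r; lra.
have r0 : 0 < r 0%N by rewrite /r /c expr0 mul1r subr_gt0.
have rm m : l ^+ m * r 0%N <= r m.
  elim: m => [|m IH]; first by rewrite mul1r.
  by rewrite exprS -mulrA; apply: le_trans (rr m); rewrite ler_wpM2l.
have [B hB] := scalar_XnM_bound (p * p).
have key m : 4 ^+ m * r 0%N <= B * K ^+ 2.
  have Km : 0 < (K ^+ 2) ^+ m by rewrite !exprn_gt0.
  rewrite -(ler_pM2r Km).
  have -> : 4 ^+ m * r 0%N * (K ^+ 2) ^+ m = l ^+ m * r 0%N.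
    rewrite lE (_ : (2 * K) ^+ 2 = 4 * K ^+ 2); last by ring.
    by rewrite [(4 * _) ^+ m]exprMn; ring.
  apply: (le_trans (rm m)); rewrite -mulrA -exprS -exprM mul2n; apply: le_trans (hB _).
  by rewrite /r -/(c m.+1) lerBlDr lerDl mulr_ge0.
have [m hm] : exists m : nat, B * K ^+ 2 < m%:R * r 0%N.
  exists (Num.bound `|B * K ^+ 2 / r 0%N|).
  by rewrite -ltr_pdivrMr//; apply: le_lt_trans (ler_norm _) (archi_boundP _).
have m4 : m%:R <= 4 ^+ m :> R by rewrite -natrX ler_nat ltnW// ltn_expl.
have := lt_le_trans hm (ler_wpM2r (ltW r0) m4).
by rewrite ltNge key.
Qed.

Local Notation C := (2 * K).
Let C0 : 0 < C. Proof. exact: mulr_gt0. Qed.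

(** Since e^2 = 1, 2 C (C + e X) = (C + e X)^2 + (C^2 - X^2), and [scalar_X2M_le] controls the last
    term. The sign e serves both ends of [-C, C]. *)
Lemma scalar_interval_ge0 (e : R) p : e ^+ 2 = 1 -> 0 <= L ((C%:P + e%:P * 'X) * (p * p)).
Proof.
move=> e2; rewrite -(@pmulr_rge0 _ (2 * C)) ?mulr_gt0// -scalar_polyCM.
have eP : e%:P * e%:P = 1 :> {poly R} by rewrite -polyCM -expr2 e2.
have -> : (2 * C)%:P * ((C%:P + e%:P * 'X) * (p * p)) =
  ((C%:P + e%:P * 'X) * p) * ((C%:P + e%:P * 'X) * p) +
  ((C ^+ 2)%:P * (p * p) - (e%:P * e%:P) * ('X^2 * (p * p))).
  have -> : (2 * C)%:P = C%:P + C%:P by rewrite (mulr_natl C 2) mulr2n polyCD.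
  have -> : (C ^+ 2)%:P = C%:P * C%:P by rewrite expr2 polyCM.
  by ring.
rewrite eP mul1r linearD addr_ge0// linearB scalar_polyCM subr_ge0; exact: scalar_X2M_le.
Qed.

(** The affine coordinate taking [-C, C] to [0, 1], where Bernstein polynomials live. *)
Definition unit_coord : {poly R} := (2 * C)^-1%:P * (C%:P + 'X).
Definition unit_coordC : {poly R} := (2 * C)^-1%:P * (C%:P - 'X).
Local Notation y := unit_coord.
Local Notation yb := unit_coordC.

Lemma unit_coordD : y + yb = 1.
Proof.
rewrite /unit_coord /unit_coordC -mulrDr.
have -> : C%:P + 'X + (C%:P - 'X) = (2 * C)%:P by rewrite (mulr_natl C 2) mulr2n polyCD; ring.
by rewrite -polyCM mulVf ?gt_eqF ?mulr_gt0.
Qed.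

Lemma scalar_unit_coord_ge0 p : 0 <= L (y * (p * p)).
Proof.
rewrite /unit_coord -mulrA scalar_polyCM; apply: mulr_ge0; first by rewrite invr_ge0 ltW// mulr_gt0.
by have := @scalar_interval_ge0 1 p; rewrite polyC1 mul1r expr1n; apply.
Qed.

Lemma scalar_unit_coordC_ge0 p : 0 <= L (yb * (p * p)).
Proof.
rewrite /unit_coordC -mulrA scalar_polyCM; apply: mulr_ge0; first by rewrite invr_ge0 ltW// mulr_gt0.
by have := @scalar_interval_ge0 (- 1) p; rewrite polyCN polyC1 mulN1r sqrrN expr1n; apply.
Qed.

(** From y + yb = 1, y yb = yb y^2 + y yb^2, which reduces to the two weights already treated. *)
Lemma scalar_unit_coord_coordC_ge0 p : 0 <= L (y * yb * (p * p)).
Proof.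
rewrite -[X in L X]mul1r -{1}unit_coordD mulrDl linearD addr_ge0//.
  by have -> : y * (y * yb * (p * p)) = yb * ((y * p) * (y * p)); [ring | exact: scalar_unit_coordC_ge0].
by have -> : yb * (y * yb * (p * p)) = y * ((yb * p) * (yb * p)); [ring | exact: scalar_unit_coord_ge0].
Qed.

(** Even parts of the exponents form a square, so only the four weights 1, y, yb and y yb remain. *)
Lemma scalar_bernstein_ge0 i j : 0 <= L (y ^+ i * yb ^+ j).
Proof.
pose p := y ^+ i./2 * yb ^+ j./2.
have -> : y ^+ i * yb ^+ j = y ^+ (odd i) * yb ^+ (odd j) * (p * p).
  rewrite -{1}(odd_double_half i) -{1}(odd_double_half j) !exprD -!addnn !exprD /p; ring.
case: (odd i) (odd j) => -[]; rewrite ?expr0 ?expr1 ?mul1r ?mulr1.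
- exact: scalar_unit_coord_coordC_ge0.
- exact: scalar_unit_coord_ge0.
- exact: scalar_unit_coordC_ge0.
- exact: Lpos.
Qed.

(** L at a Bernstein basis polynomial: the mass at j / n of the n-th discrete approximation. *)
Definition bernstein_weight n j := L (y ^+ j * yb ^+ (n - j)) *+ 'C(n, j).

Lemma bernstein_weight_ge0 n j : 0 <= bernstein_weight n j.
Proof. by rewrite /bernstein_weight mulrn_wge0 ?scalar_bernstein_ge0. Qed.

(** Factorial moments are exact: 'C(n, j + k) times (j + k) ^_ k is 'C(n - k, j) times n ^_ k, and
    what is left is the binomial expansion of y^k (y + yb)^(n - k) = y^k. Ordinary moments follow in
    the limit by [ffact_ratio]. *)
Lemma bernstein_weight_moment n k : (k <= n)%N ->
  \sum_(j < n.+1) bernstein_weight n j * (j ^_ k)%:R = (n ^_ k)%:R * L (y ^+ k).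
Proof.
move=> kn; have E : y ^+ k = \sum_(j < (n - k).+1) (y ^+ (j + k) * yb ^+ (n - (j + k))) *+ 'C(n - k, j).
  rewrite -[LHS]mulr1 -(expr1n _ (n - k)) -unit_coordD addrC exprDn mulr_sumr; apply: eq_bigr => j _.
  have -> : (n - (j + k) = n - k - j)%N by lia.
  by rewrite mulrnAr exprD; congr (_ *+ _); ring.
rewrite E linear_sum mulr_sumr -(big_mkord xpredT (fun j => bernstein_weight n j * (j ^_ k)%:R)).
rewrite (big_cat_nat (n := k))//=; last by lia.
rewrite [X in X + _]big1_seq ?add0r; last first.
  by move=> j; rewrite mem_index_iota => /andP[_ /andP[_ jk]]; rewrite ffact_small ?mulr0.
rewrite -{1}[k]add0n big_addn big_mkord subSn//; apply: eq_bigr => -[j /= jk] _.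
rewrite /bernstein_weight linearMn; set T := L _.
transitivity (T * ('C(n, j + k) * (j + k) ^_ k)%N%:R); first by rewrite natrM mulrA [T * _]mulr_natr.
transitivity (T * ('C(n - k, j) * n ^_ k)%N%:R); last by rewrite natrM mulrA [T * _]mulr_natr mulrC.
congr (_ * _%:R).
have h1 : (j + k <= n)%N by lia.
have h2 : (k <= j + k)%N by lia.
have f1 := bin_fact h1.
have f2 : 'C(n - k, j) * (j`! * (n - k - j)`!) = (n - k)`! by apply: bin_fact; lia.
have f3 := ffact_fact h2. have f4 := ffact_fact kn.
rewrite addnK in f3.
apply/eqP; rewrite -(eqn_pmul2r (fact_gt0 j)) -(eqn_pmul2r (fact_gt0 (n - (j + k)))); apply/eqP.
have e : (n - (j + k) = n - k - j)%N by lia.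
rewrite e in f1 *; move: f1 f2 f3 f4; nia.
Qed.

End PositiveFunctional.

(** * Quantile functions of discrete measures and their limits *)

Section Quantile.
Variable R : realType.

(** b holds on an initial segment, so the sum telescopes up to the length of that segment. *)
Lemma sum_initial (F : nat -> R) (b : nat -> bool) n :
    (forall j, b j.+1 -> b j) ->
  \sum_(j < n) (F j.+1 - F j) * (b j)%:R = F (\sum_(j < n) b j)%N - F 0%N.
Proof.
move=> bS; have bmono i j : (i <= j)%N -> b j -> b i.
  by elim: j => [|j IH]; [rewrite leqn0 => /eqP ->|rewrite leq_eqVlt => /predU1P[-> //|ij /bS]; exact: IH].
elim: n => [|n IH]; first by rewrite !big_ord0 subrr.
rewrite !big_ord_recr/= IH; case bn: (b n); last by rewrite mulr0 addr0 addn0.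
have -> : (\sum_(j < n) b j = n)%N.
  rewrite -[RHS]muln1 -[in RHS](card_ord n) -sum_nat_const; apply: eq_bigr => i _.
  by rewrite (bmono i n)// ltnW.
by rewrite mulr1 addn1; ring.
Qed.

(** A right-endpoint Riemann sum of the indicator of ]W, 1]: the count is m minus the integer part
    of m W. *)
Lemma riemann_step (W : R) m : 0 <= W <= 1 -> (0 < m)%N ->
  `|m%:R^-1 * \sum_(i < m) (W < i.+1%:R / m%:R)%R%:R - (1 - W)| <= m%:R^-1.
Proof.
move=> /andP[W0 W1] m0; have m0' : 0 < m%:R :> R by rewrite ltr0n.
pose f := Num.truncn (m%:R * W).
have mW0 : 0 <= m%:R * W by rewrite mulr_ge0.
have /andP[f1 f2] := truncn_itv mW0; rewrite -/f in f1 f2.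
have fm : (f <= m)%N by rewrite -(ler_nat R); apply: (le_trans f1); rewrite ler_piMr// ler0n.
have cE : \sum_(i < m) (W < i.+1%:R / m%:R)%R%:R = m%:R - f%:R :> R.
  rewrite -natrB// -natr_sum; congr _%:R.
  transitivity (\sum_(i < m) (f <= i)%N)%N.
    by apply: eq_bigr => i _; rewrite ltr_pdivlMr// mulrC -truncn_lt_nat.
  elim: (m) => [|k IH]; first by rewrite big_ord0.
  by rewrite big_ord_recr/= IH; case: (leqP f k); lia.
rewrite cE -(ler_pM2l m0') divff ?gt_eqF// -[X in X * `|_|](gtr0_norm m0') -normrM.
rewrite mulrBr mulrA divff ?gt_eqF// mul1r ler_norml; apply/andP; split; lra.
Qed.

Section Discrete.
Variables (n : nat) (w : nat -> R).
Hypothesis n0 : (0 < n)%N.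
Hypothesis w0 : forall j, 0 <= w j.
Hypothesis w1 : \sum_(j < n.+1) w j = 1.

Let W j := \sum_(i < j.+1) w i.

(** For the masses w j at j / n, the quantile at u is the first atom whose cumulative mass reaches
    u; its index is the number of atoms whose cumulative mass stays below u. *)
Definition quantile (u : R) : R := n%:R^-1 * (\sum_(j < n) (W j < u)%R)%N%:R.

Let W_nd : {homo W : i j / (i <= j)%N >-> i <= j}.
Proof.
by apply: homo_leq => [x|y x z|i]; [exact: lexx|exact: le_trans|rewrite /W [leRHS]big_ord_recr/= lerDl].
Qed.

Let W_itv j : (j <= n)%N -> 0 <= W j <= 1.
Proof.
by move=> jn; rewrite -w1 W_nd// andbT; apply: sumr_ge0 => i _; exact: w0.
Qed.

Lemma quantile_nd : {homo quantile : u v / u <= v}.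
Proof.
move=> u v uv; rewrite /quantile ler_wpM2l ?invr_ge0// ler_nat; apply: leq_sum => j _.
by case: ltP => // Wu; rewrite (lt_le_trans Wu uv).
Qed.

Lemma quantile_itv u : 0 <= quantile u <= 1.
Proof.
rewrite /quantile mulr_ge0 ?invr_ge0//= ler_pdivrMl ?ltr0n// mulr1 ler_nat.
by rewrite -[leqRHS]muln1 -[in leqRHS](card_ord n) -sum_nat_const; apply: leq_sum => j _; exact: leq_b1.
Qed.

(** Summation by parts. *)
Lemma sum_quantile (F : nat -> R) k :
  \sum_(j < k) (F j.+1 - F j) * (W k - W j) = \sum_(j < k.+1) w j * (F j - F 0%N).
Proof.
elim: k => [|k IH]; first by rewrite big_ord0 big_ord_recl big_ord0 subrr mulr0 addr0.
rewrite big_ord_recr/= [RHS]big_ord_recr/= -IH.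
have -> : W k.+1 = W k + w k.+1 by rewrite /W big_ord_recr.
have tele : \sum_(j < k) (F j.+1 - F j) = F k - F 0%N.
  by rewrite -(big_mkord xpredT (fun j => F j.+1 - F j)) telescope_sumr.
rewrite (eq_bigr (fun j : 'I_k => (F j.+1 - F j) * (W k - W j) + (F j.+1 - F j) * w k.+1)); last first.
  by move=> j _; ring.
by rewrite big_split/= -mulr_suml tele; ring.
Qed.

(** The k-th power of the quantile is a combination of the indicators W j < u with nonnegative
    coefficients of sum 1, so [riemann_step] applies to each. The error 1 / m depends neither on n
    nor on the weights and therefore survives the limit in n. *)
Lemma quantile_riemann m k : (0 < m)%N -> (0 < k)%N ->
  `|m%:R^-1 * \sum_(i < m) quantile (i.+1%:R / m%:R) ^+ k
    - \sum_(j < n.+1) w j * (j%:R / n%:R) ^+ k| <= m%:R^-1.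
Proof.
move=> m0 k0; pose F j : R := (j%:R / n%:R) ^+ k.
have F0 : F 0%N = 0 by rewrite /F mul0r expr0n gtn_eqF.
have F1 : F n = 1 by rewrite /F divff ?expr1n// pnatr_eq0 -lt0n.
have dF0 j : 0 <= F j.+1 - F j.
  by rewrite subr_ge0 /F lerXn2r ?nnegrE ?divr_ge0// ler_wpM2r ?invr_ge0// ler_nat.
have Wn : W n = 1 by [].
have -> : \sum_(j < n.+1) w j * F j = \sum_(j < n) (F j.+1 - F j) * (1 - W j).
  rewrite -Wn sum_quantile; apply: eq_bigr => j _; by rewrite F0 subr0.
have qE u : quantile u ^+ k = \sum_(j < n) (F j.+1 - F j) * (W j < u)%R%:R.
  rewrite (@sum_initial F (fun j => W j < u)).
    by rewrite F0 subr0 /quantile /F mulrC.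
  by move=> j; apply: le_lt_trans; exact: W_nd.
have -> : m%:R^-1 * \sum_(i < m) quantile (i.+1%:R / m%:R) ^+ k =
    \sum_(j < n) (F j.+1 - F j) * (m%:R^-1 * \sum_(i < m) (W j < i.+1%:R / m%:R)%R%:R).
  under eq_bigr do rewrite qE.
  rewrite exchange_big/= mulr_sumr; apply: eq_bigr => j _.
  by rewrite -mulr_sumr; ring.
rewrite -sumrB; apply: (le_trans (ler_norm_sum _ _ _)).
rewrite [leRHS](_ : _ = \sum_(j < n) (F j.+1 - F j) * m%:R^-1); last first.
  by rewrite -mulr_suml -(big_mkord xpredT (fun j => F j.+1 - F j)) telescope_sumr// F0 F1 subr0 mul1r.
apply: ler_sum => j _; rewrite -mulrBr normrM ger0_norm// ler_wpM2l//.
by apply: riemann_step => //; apply: W_itv; exact: ltnW.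
Qed.

End Discrete.

Lemma ultra_fmap (S T : Type) (f : S -> T) (F : set_system S) :
  UltraFilter F -> UltraFilter (f @ F).
Proof.
move=> UF; split => [|G PG sFG]; first exact: fmap_proper_filter.
rewrite predeqE => A; split => [GA|/sFG//].
have [//|nA] := in_ultra_setVsetC (f @^-1` A) UF.
have /sFG GnA : (f @ F) (~` A) by exact: nA.
have G0 : G (A `&` ~` A) by exact: filterI.
by exfalso; move: G0; rewrite setICr; exact: filter_not_empty.
Qed.

Lemma cvg_exprn (T : Type) (F : set_system T) (FF : Filter F) (f : T -> R) (a : R) k :
  f @ F --> a -> (fun x => f x ^+ k) @ F --> a ^+ k.
Proof.
move=> fa; elim: k => [|k IH]; first exact: cvg_cst.
rewrite exprS (_ : (fun x => _) = f \* (fun x => f x ^+ k)); first exact: cvgM.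
by apply/funext => x /=; rewrite exprS.
Qed.

(** An ultrafilter finer than the one at infinity makes the quantiles converge at every u at once,
    by compactness of [0, 1], with no diagonal extraction. Each Riemann sum is finite, so it passes
    to the limit. *)
Lemma quantile_limit (w : nat -> nat -> R) (mom : nat -> R) :
    (forall n j, 0 <= w n j) -> (forall n, \sum_(j < n.+1) w n j = 1) ->
    (forall k, (fun n => \sum_(j < n.+1) w n j * (j%:R / n%:R) ^+ k) @ \oo --> mom k) ->
  exists X : R -> R, [/\ {homo X : u v / u <= v}, (forall u, 0 <= X u <= 1) &
    forall m k, (0 < m)%N -> (0 < k)%N ->
      `|m%:R^-1 * \sum_(i < m) X (i.+1%:R / m%:R) ^+ k - mom k| <= m%:R^-1].
Proof.
move=> w0 w1 hm.
have [U [UU UF]] := @ultraFilterLemma nat (nbhs \oo) _.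
have PU : ProperFilter U by exact: ultra_proper.
(* The shift avoids n = 0, where the grid j / n degenerates. *)
pose q n := quantile n.+1 (w n.+1).
have XX : forall u : R, exists x : R, (fun n => q n u) @ U --> x.
  move=> u; have := @segment_compact R 0 1; rewrite compact_ultra => /(_ ((fun n => q n u) @ U) _ _)[].
  - by exact: ultra_fmap.
  - by apply: (@filterE _ U) => n /=; rewrite in_itv/=; exact: quantile_itv.
  - by move=> x [_ xE]; exists x.
have [X XE] := choice XX.
exists X; split.
- move=> u v uv; apply: (ler_cvg_to (XE u) (XE v)); apply: nearW => n; exact: quantile_nd.
- move=> u; apply/andP; split.
    by apply: (cvgr_to_ge (XE u)); apply: nearW => n; case/andP: (@quantile_itv n.+1 (w n.+1) isT u).
  by apply: (cvgr_to_le (XE u)); apply: nearW => n; case/andP: (@quantile_itv n.+1 (w n.+1) isT u).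
- move=> m k m0 k0.
  have h1 : (fun n => m%:R^-1 * \sum_(i < m) q n (i.+1%:R / m%:R) ^+ k) @ U -->
     m%:R^-1 * \sum_(i < m) X (i.+1%:R / m%:R) ^+ k.
    apply: cvgM; first exact: cvg_cst.
    apply: cvg_big => [|i _]; first exact: add_continuous.
    by apply: cvg_exprn; exact: XE.
  have h2 : (fun n => \sum_(j < n.+2) w n.+1 j * (j%:R / n.+1%:R) ^+ k) @ U --> mom k.
    have hS := hm k; rewrite -cvg_shiftS in hS.
    exact: cvg_trans (cvg_app _ UF) hS.
  have h3 := cvg_norm (cvgB h1 h2).
  apply: (cvgr_to_le (h3 _ _)); apply: nearW => n /=.
  exact: quantile_riemann.
Qed.

End Quantile.

(** * Riemann sums of monotone functions *)

Section RiemannMonotone.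
Variable R : realType.
Local Notation lam := (@lebesgue_measure R).
Variable g : R -> R.
Hypothesis g_nd : {homo g : u v / u <= v}.
Hypothesis g01 : forall u, 0 <= g u <= 1.

Let mg D : measurable D -> measurable_fun D (EFin \o g).
Proof. by move=> mD; apply/measurable_EFinP; exact: nondecreasing_measurable. Qed.

Let g0 u : (0 <= (g u)%:E)%E.
Proof. by rewrite lee_fin; case/andP: (g01 u). Qed.

Let piece a b : a <= b ->
  ((g a * (b - a))%:E <= \int[lam]_(x in `]a, b]) (g x)%:E <= (g b * (b - a))%:E)%E.
Proof.
move=> ab; have ms : measurable (`]a, b]%classic : set R) by [].
have lamE : lam `]a, b]%classic = (b - a)%:E.
  rewrite lebesgue_measure_itv/= lte_fin; case: ltgtP ab => // -> _; by rewrite subrr.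
have mgs := mg ms.
rewrite !EFinM -lamE -!integral_cst//; apply/andP; split; apply: ge0_le_integral => //=.
- by move=> x; rewrite in_itv/= lee_fin => /andP[/ltW ax _]; exact: g_nd.
- by move=> x; rewrite in_itv/= lee_fin => /andP[_]; exact: g_nd.
Qed.

(** The integral lies between the left and right Riemann sums, which differ by (g 1 - g 0) / m. *)
Lemma riemann_monotone m : (0 < m)%N ->
  exists2 I : R, (\int[lam]_(x in `[0%R, 1%R]) (g x)%:E = I%:E)%E &
   `|I - m%:R^-1 * \sum_(i < m) g (i.+1%:R / m%:R)| <= m%:R^-1.
Proof.
move=> m0; have m0' : 0 < m%:R :> R by rewrite ltr0n.
have bounds k : exists2 I : R, (\int[lam]_(x in `]0%R, (k%:R / m%:R)%R]) (g x)%:E = I%:E)%E &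
   m%:R^-1 * \sum_(i < k) g (i%:R / m%:R) <= I <= m%:R^-1 * \sum_(i < k) g (i.+1%:R / m%:R).
  elim: k => [|k [I IE /andP[I1 I2]]].
    exists 0; last by rewrite !big_ord0 mulr0 lexx.
    by rewrite mul0r set_itv_ge ?integral_set0// bnd_simp ltxx.
  have le1 : k%:R / m%:R <= k.+1%:R / m%:R :> R by rewrite ler_pM2r ?invr_gt0// ler_nat.
  have d1 : k.+1%:R / m%:R - k%:R / m%:R = m%:R^-1 :> R.
    by rewrite -mulrBl -natrB// subSnn mul1r.
  have /andP[J1 J2] := piece le1.
  have Jfin : (\int[lam]_(x in `](k%:R / m%:R)%R, (k.+1%:R / m%:R)%R]) (g x)%:E)%E \is a fin_num.
    rewrite fin_numE; apply/andP; split; apply/eqP => J.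
      by move: J1; rewrite J.
    by move: J2; rewrite J.
  move: J1 J2; rewrite -(fineK Jfin) !lee_fin d1; set J := fine _ => J1 J2.
  exists (I + J); last first.
    rewrite !big_ord_recr/= !mulrDr; apply/andP; split; apply: lerD => //; by rewrite mulrC.
  have -> : `]0%R, (k.+1%:R / m%:R)%R]%classic =
      `]0%R, (k%:R / m%:R)%R] `|` `](k%:R / m%:R)%R, (k.+1%:R / m%:R)%R] :> set R.
    by rewrite -itv_bndbnd_setU ?bnd_simp// divr_ge0// ltW.
  rewrite ge0_integral_setU//=.
  - by rewrite IE EFinD /J fineK.
  - by apply: mg; exact: measurableU.
  - apply/disj_setPS => x [/=]; rewrite !in_itv/= => /andP[_ xk] /andP[kx _].
    by move: (lt_le_trans kx xk); rewrite ltxx.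
have [I IE /andP[I1 I2]] := bounds m; exists I.
  by rewrite -IE divff ?gt_eqF// integral_itv_obnd_cbnd//; exact: mg.
rewrite distrC ger0_norm ?subr_ge0// lerBlDl -lerBlDr; apply: le_trans I1.
rewrite lerBlDr -[X in _ <= _ + X]mulr1 -mulrDr ler_pM2l ?invr_gt0//.
case: m m0 {m0' bounds IE I2} => // m _; rewrite big_ord_recr/= [X in _ <= X + _]big_ord_recl/=.
have /andP[h0 _] := g01 (0%:R / m.+1%:R).
have /andP[_ h1] := g01 (m.+1%:R / m.+1%:R).
rewrite [X in _ <= _ + X + _](_ : _ = \sum_(i < m) g (i.+1%:R / m.+1%:R)); last first.
  by apply: eq_bigr.
by move: h0 h1; lra.
Qed.

Lemma integral_monotone_limit (c : R) :
  (forall m, (0 < m)%N -> `|m%:R^-1 * \sum_(i < m) g (i.+1%:R / m%:R) - c| <= m%:R^-1) ->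
  (\int[lam]_(x in `[0%R, 1%R]) (g x)%:E = c%:E)%E.
Proof.
move=> hc; have [I IE _] := riemann_monotone (isT : (0 < 1)%N).
rewrite IE; congr (_%:E); apply/eqP; rewrite -subr_eq0 -normr_le0.
have h m : (0 < m)%N -> `|I - c| <= 2 * m%:R^-1.
  move=> m0; have [I' IE' hI] := riemann_monotone m0.
  have -> : I = I' by move: IE'; rewrite IE => -[].
  have := hc m m0; move: hI.
  set r := _ * _ => h1 h2; rewrite (_ : I' - c = (I' - r) + (r - c)); last by ring.
  by apply: (le_trans (ler_normD _ _)); rewrite mulr_natl mulr2n; exact: lerD.
apply/ler_addgt0Pr => e e0; rewrite add0r.
pose m := (Num.truncn (2 / e)).+1.
apply: (le_trans (h m isT)).
rewrite ler_pdivrMr ?ltr0n// mulrC -ler_pdivrMr//.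
by apply: ltW; exact: truncnS_gt.
Qed.

End RiemannMonotone.

Section Moments.
Variable R : realType.

(** Replacing the factor (j - k) / (n - k) by j / n costs at most k / n, all factors being in
    [0, 1]; the costs add up to at most k^2 / n. *)
Lemma ffact_ratio (n j k : nat) : (j <= n)%N -> (k <= n)%N -> (0 < n)%N ->
  `|(j ^_ k)%:R / (n ^_ k)%:R - (j%:R / n%:R) ^+ k| <= (k * k)%:R / n%:R :> R.
Proof.
move=> jn kn n0; have n0' : 0 < n%:R :> R by rewrite ltr0n.
have b01 : 0 <= (j%:R / n%:R : R) <= 1.
  by rewrite divr_ge0//= ler_pdivrMr// mul1r ler_nat.
have a01 i : 0 <= ((j ^_ i)%:R / (n ^_ i)%:R : R) <= 1.
  rewrite divr_ge0//=; have [ni|ni] := leqP i n; last first.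
    by rewrite ffact_small ?mul0r//; lia.
  rewrite ler_pdivrMr ?ltr0n ?ffact_gt0// mul1r ler_nat.
  elim: i {ni} => [|i IH]; first by rewrite !ffactn0.
  by rewrite !ffactnSr leq_mul// leq_sub2r.
elim: k kn => [|k IH] kn; first by rewrite !ffactn0 divr1 subrr normr0 mul0r.
have {}IH := IH (ltnW kn).
rewrite !ffactnSr !(natrM _ _ (_ - k)) exprSr.
set a := (j ^_ k)%:R / (n ^_ k)%:R in IH *; set b := j%:R / n%:R in IH b01 *.
have -> : (j ^_ k)%:R * (j - k)%:R / ((n ^_ k)%:R * (n - k)%:R) = a * ((j - k)%:R / (n - k)%:R) :> R.
  by rewrite /a invfM; ring.
have -> : a * ((j - k)%:R / (n - k)%:R) - b ^+ k * b = a * ((j - k)%:R / (n - k)%:R - b) + (a - b ^+ k) * b.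
  by ring.
apply: (le_trans (ler_normD _ _)); rewrite (normrM a) (normrM (a - b ^+ k)).
have /andP[b0 b1] := b01; have /andP[a0 a1] := a01 k; rewrite -/a in a0 a1.
have h2 : `|a - b ^+ k| * `|b| <= (k * k)%:R / n%:R.
  by apply: (le_trans _ IH); rewrite ler_piMr// ger0_norm.
have h1 : `|a| * `|(j - k)%:R / (n - k)%:R - b| <= k%:R / n%:R.
  (* For j < k the natural subtraction j - k truncates, but then the factor a vanishes. *)
  have [kj|jk] := leqP k j; last first.
    by rewrite /a ffact_small// mul0r normr0 mul0r divr_ge0.
  rewrite ger0_norm//; apply: (@le_trans _ _ `|(j - k)%:R / (n - k)%:R - b|); first by rewrite ler_piMl.
  have nk0 : 0 < n%:R - k%:R :> R by rewrite subr_gt0 ltr_nat.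
  have jn' : j%:R <= n%:R :> R by rewrite ler_nat.
  have kj' : k%:R <= j%:R :> R by rewrite ler_nat.
  have k0' : 0 <= k%:R :> R by [].
  rewrite !natrB// ?(ltnW kn)//.
  have -> : (j%:R - k%:R) / (n%:R - k%:R) - b = - (k%:R / n%:R * ((n%:R - j%:R) / (n%:R - k%:R))).
    by rewrite /b; field; rewrite !gt_eqF.
  rewrite normrN ger0_norm; last by rewrite mulr_ge0 ?divr_ge0 ?subr_ge0// ler_nat ltnW.
  rewrite ler_piMr ?divr_ge0// ler_pdivrMr// mul1r lerB//.
apply: (le_trans (lerD h1 h2)).
by rewrite -mulrDl ler_pM2r ?invr_gt0// -natrD ler_nat; nia.
Qed.

Section Functional.
Variables (L : {scalar {poly R}}) (A K : R).
Hypothesis Lpos : forall p, 0 <= L (p * p).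
Hypothesis L1 : L 1 = 1.
Hypothesis K0 : 0 < K.
Hypothesis Lbound : forall n, `|L 'X^n| <= A * K ^+ n.

Let w n j := bernstein_weight L K n j.
Let w0 n j : 0 <= w n j. Proof. exact: (bernstein_weight_ge0 Lpos K0 Lbound). Qed.

Let w_moment n k : (k <= n)%N ->
  \sum_(j < n.+1) w n j * (j ^_ k)%:R = (n ^_ k)%:R * L (unit_coord K ^+ k).
Proof. by move=> kn; apply: bernstein_weight_moment. Qed.

Let w1 n : \sum_(j < n.+1) w n j = 1.
Proof.
transitivity ((n ^_ 0)%:R * L (unit_coord K ^+ 0)); last by rewrite expr0 L1 mulr1.
by rewrite -w_moment//; apply: eq_bigr => j _; rewrite ffactn0 mulr1.
Qed.

Let w_cvg k : (fun n => \sum_(j < n.+1) w n j * (j%:R / n%:R) ^+ k) @ \oo --> L (unit_coord K ^+ k).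
Proof.
have h : (fun n => (k * k)%:R / n%:R : R) @ \oo --> (0 : R).
  rewrite -[X in _ --> X](mulr0 ((k * k)%:R)); apply: cvgM; first exact: cvg_cst.
  have : (fun n => n%:R^-1 : R) @ \oo --> (0 : R) by rewrite -cvg_shiftS; exact: cvg_harmonic.
  exact.
apply/cvgrPdist_le => e e0; have /cvgrPdist_le/(_ _ e0) he := h.
near=> n.
have kn : (k <= n)%N by near: n; exact: nbhs_infty_ge.
have n0 : (0 < n)%N by near: n; exact: nbhs_infty_gt.
apply: (@le_trans _ _ ((k * k)%:R / n%:R)); last first.
  have : `|0 - (k * k)%:R / n%:R| <= e by near: n.
  by rewrite sub0r normrN ger0_norm ?divr_ge0.
have fn0 : (n ^_ k)%:R != 0 :> R by rewrite pnatr_eq0 -lt0n ffact_gt0.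
have -> : L (unit_coord K ^+ k) = \sum_(j < n.+1) w n j * ((j ^_ k)%:R / (n ^_ k)%:R).
  apply: (mulfI fn0); rewrite -w_moment// mulr_sumr; apply: eq_bigr => j _.
  by rewrite mulrCA; congr (_ * _); rewrite mulrCA divff ?mulr1.
rewrite -sumrB; apply: (le_trans (ler_norm_sum _ _ _)).
rewrite [leRHS](_ : _ = \sum_(j < n.+1) w n j * ((k * k)%:R / n%:R)); last first.
  by rewrite -mulr_suml w1 mul1r.
apply: ler_sum => j _.
rewrite -mulrBr normrM ger0_norm// ler_wpM2l//; apply: ffact_ratio => //.
by rewrite -ltnS.
Unshelve. all: by end_near. Qed.

(** The measure is the law of 2 C X(U) - C with U uniform on [0, 1], where X is the limit quantile
    function and X |-> 2 C X - C undoes [unit_coord]. *)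
Lemma functional_probability : exists mu : probability R R,
  forall n, moment mu n = (L 'X^n)%:E.
Proof.
have [X [X_nd X01 hX]] := quantile_limit w0 w1 w_cvg.
have Xk k : (\int[lebesgue_measure]_(x in `[0%R, 1%R]) (X x ^+ k)%:E = (L (unit_coord K ^+ k))%:E)%E.
  case: k => [|k].
    rewrite expr0 L1 (eq_integral (cst 1%E)) ?integral_cst//=.
    by rewrite lebesgue_measure_itv/= lte_fin ltr01 oppr0 mul1e adde0.
  have X0 u : 0 <= X u by case/andP: (X01 u).
  apply: (@integral_monotone_limit _ (fun x => X x ^+ k.+1)).
  - by move=> u v uv; rewrite lerXn2r ?nnegrE ?X_nd.
  - by move=> u; rewrite exprn_ge0//= exprn_ile1//; case/andP: (X01 u).
  - by move=> m m0; exact: hX.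
pose C := 2 * K; have C0 : 0 < C by exact: mulr_gt0.
pose U : probability (measurableTypeR R) R := uniform_prob (@ltr01 R).
pose h (u : measurableTypeR R) : R := 2 * C * X u - C.
have mX : measurable_fun [set: measurableTypeR R] X by exact: nondecreasing_measurable.
have mh : measurable_fun [set: measurableTypeR R] h.
  by apply: measurable_funB => //; apply: measurable_funM.
pose H : {mfun measurableTypeR R >-> R} := HB.pack h (isMeasurableFun.Build _ _ _ _ h mh).
exists (distribution U H) => n.
(* Composing q with [unit_coord] gives 'X^n, so the moment of h splits into those of X, known from
   [Xk]. *)
pose q : {poly R} := ((2 * C)%:P * 'X - C%:P) ^+ n.
have hq u : h u ^+ n = \sum_(k < size q) q`_k * X u ^+ k.
  by rewrite -horner_coef /q horner_exp hornerD hornerN hornerM hornerX !hornerC.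
have bX k : U.-integrable setT (EFin \o (fun u => X u ^+ k)).
  apply: measurable_bounded_integrable => //.
  - have U1 : U setT = 1%E := probability_setT U.
    by rewrite [ltLHS]U1 ltry.
  - exact: measurable_funX.
  - exists 1; split => // M M1 u _ /=; have /andP[X0 X1] := X01 u.
    by rewrite ger0_norm ?exprn_ge0// (le_trans (exprn_ile1 _ _ _))// ltW.
have bqX k : U.-integrable setT (fun u => (q`_k * X u ^+ k)%:E).
  rewrite (_ : (fun _ => _) = (fun u : measurableTypeR R => (q`_k)%:E * (X u ^+ k)%:E)%E)//.
  by apply: integrableZl => //; exact: bX.
have Uh : (\int[U]_u (h u ^+ n)%:E = (L 'X^n)%:E)%E.
  under eq_integral do rewrite hq -sumEFin.
  rewrite integral_sum//.
  have step k : (\int[U]_u (q`_k * X u ^+ k)%:E = (L (q`_k *: unit_coord K ^+ k))%:E)%E.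
    under eq_integral do rewrite EFinM.
    rewrite integralZl//; last exact: bX.
    rewrite linearZ EFinM; congr (_ * _)%E.
    rewrite integral_uniform//=.
    - by rewrite subr0 invr1 mul1e Xk.
    - by apply/measurable_EFinP; exact: measurable_funX.
    - by move=> x; rewrite lee_fin exprn_ge0//; case/andP: (X01 x).
  under eq_bigr do rewrite step.
  rewrite sumEFin -linear_sum; congr (L _)%:E.
  have -> : 'X^n = q \Po unit_coord K.
    rewrite /q rmorphXn/= comp_polyB comp_polyM comp_polyX !comp_polyC; congr (_ ^+ n).
    rewrite /unit_coord -/C [(2 * C)%:P * _]mulrA -polyCM divff ?gt_eqF ?mulr_gt0//.
    by rewrite mul1r addrC addrA; ring.
  by rewrite [in RHS]comp_polyE.
rewrite /moment integral_distribution//=.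
  by apply/measurable_EFinP; exact: measurable_funX.
rewrite (_ : _ \o _ = fun u => \sum_(k < size q) (q`_k * X u ^+ k)%:E)%E.
  by apply: integrable_sum.
by apply/funext => u /=; rewrite hq sumEFin.
Qed.

End Functional.

Theorem hamburger_bounded (M : fps R) (A K : R) : M`@_0 = 1 -> 0 < K ->
    (forall n, `|M`@_n| <= A * K ^+ n) -> (forall N, psd N (hankel M)) ->
  exists mu : probability R R, forall n, moment mu n = (M`@_n)%:E.
Proof.
move=> M0 K0 hM pM.
pose L0 (p : {poly R}) := \sum_(i < size p) p`_i * M`@_i.
have L0w n (p : {poly R}) : (size p <= n)%N -> L0 p = \sum_(i < n) p`_i * M`@_i.
  move=> pn; rewrite /L0 (big_ord_widen_cond n xpredT (fun i => p`_i * M`@_i))//=.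
  rewrite big_mkcond/=; apply: eq_bigr => i _; case: ltnP => // pi.
  by rewrite nth_default ?mul0r.
have L0lin : scalar L0.
  move=> a p q; pose n := maxn (size (a *: p + q)) (maxn (size p) (size q)).
  rewrite !(L0w n) ?leq_maxr ?leq_max ?leqnn ?orbT// mulr_sumr -big_split/=.
  by apply: eq_bigr => i _; rewrite coefD coefZ; ring.
have [L LX] : exists L : {scalar {poly R}}, forall n, L 'X^n = M`@_n.
  pose L : {scalar {poly R}} := HB.pack L0 (GRing.isLinear.Build _ _ _ _ L0 L0lin).
  exists L => n.
  rewrite /= /L0 size_polyXn big_ord_recr/= coefXn eqxx mul1r big1 ?add0r// => i _.
  by rewrite coefXn ltn_eqF ?mul0r.
have Lpq p q : L (p * q) =
    \sum_(i < size p) \sum_(j < size q) p`_i * q`_j * M`@_(i + j).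
  rewrite -{1}[p]coefK -{1}[q]coefK !poly_def mulr_suml linear_sum/=; apply: eq_bigr => i _.
  rewrite -scalerAl linearZ/= mulr_sumr linear_sum/= mulr_sumr; apply: eq_bigr => j _.
  by rewrite -scalerAr linearZ/= -exprD LX mulrA.
have [mu hmu] : exists mu : probability R R, forall n, moment mu n = (L 'X^n)%:E.
  apply: (functional_probability (A := A) (K := K)) => //.
  - move=> p; have := pM (size p) (fun i => p`_i).
    by rewrite Lpq.
  - by rewrite -[1](expr0 'X) LX.
  - by move=> n; rewrite LX.
by exists mu => n; rewrite hmu LX.
Qed.

End Moments.

(** * Free convolution roots in the family *)

Section FreeDivisibility.
Variable R : realType.
Implicit Types (mu nu : probability R R) (s t : R).

Definition in_family s t mu := compactly_supported mu /\ is_Rtransform mu (Rst s t).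

Lemma zeta_rel_in_family s t z M mu : 0 <= s -> 0 <= t -> zeta_rel s t z M ->
  has_moments mu M -> in_family s t mu.
Proof.
move=> s0 t0 H hM; split; [exact: zeta_rel_compact s0 t0 H hM|exact: zeta_rel_Rtransform s0 t0 H hM].
Qed.

Lemma in_family_ex s t : 0 <= s -> 0 <= t -> exists mu, in_family s t mu.
Proof.
move=> s0 t0; have [z [M H]] := zeta_rel_ex s t.
have [r [r0 _ [B hB]]] := zeta_rel_bounded s0 t0 H.
have [mu hmu] : exists mu : probability R R, forall n, moment mu n = (M`@_n)%:E.
  apply: (@hamburger_bounded _ M B r^-1).
  - have [z0 -> _] := H.
    by rewrite !fpscoefD !fpscoefM0 z0 !mulr0 mul0r !addr0.
  - by rewrite invr_gt0.
  - move=> n; rewrite exprVn ler_pdivlMr ?exprn_gt0//.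
    by apply: le_trans (hB n.+1); apply: fps_norm_coef => //; exact: ltW.
  - exact: psd_hankel s0 t0 H.
by exists mu; exact: zeta_rel_in_family H hmu.
Qed.

Lemma in_family_conv s1 t1 s2 t2 mu mu1 mu2 :
  in_family (s1 + s2) (t1 + t2) mu -> in_family s1 t1 mu1 -> in_family s2 t2 mu2 ->
  is_free_conv mu mu1 mu2.
Proof.
move=> [c r] [c1 r1] [c2 r2]; split=> //.
exists (Rst (s1 + s2) (t1 + t2)), (Rst s1 t1), (Rst s2 t2); split=> //.
by exists 1 => // w _; rewrite /Rst; ring.
Qed.

(** The sequence f supplies the intermediate measure that [free_powS] asks for at every step. *)
Lemma in_family_free_pow s t (f : nat -> probability R R) n :
  (forall k, in_family (k%:R * s) (k%:R * t) (f k)) -> free_powS (f 1%N) n (f n.+1).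
Proof.
move=> hf; elim: n => [//|n IH]; exists (f n.+1); split => //.
apply: (in_family_conv (s1 := n.+1%:R * s) (t1 := n.+1%:R * t) (s2 := 1%:R * s) (t2 := 1%:R * t)) => //.
by rewrite -!mulrDl -natrD addn1.
Qed.

Lemma in_family_inf_divisible s t mu : 0 <= s -> 0 <= t -> in_family s t mu ->
  free_inf_divisible mu.
Proof.
move=> s0 t0 hmu [//|[|N]] _; first by exists mu.
have N0 : N.+2%:R != 0 :> R by rewrite pnatr_eq0.
have ex_f : forall k : nat, exists nu, in_family (k%:R * (s / N.+2%:R)) (k%:R * (t / N.+2%:R)) nu.
  by move=> k; apply: in_family_ex; rewrite mulr_ge0 ?divr_ge0.
have [f hf] := choice ex_f.
(* The last convolution must produce mu itself, not the chosen f N.+2, so it is treated apart;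
   membership of mu in the family is enough for it. *)
exists (f 1%N), (f N.+1); split; first exact: in_family_free_pow hf.
apply: in_family_conv (hf _) (hf _).
by rewrite -!mulrDl -natrD addn1 ![N.+2%:R * _]mulrC !divfK.
Qed.

End FreeDivisibility.

(** * Fuss-Catalan numbers *)

Section FussCatalan.
Variable R : realFieldType.
Local Notation X := (fpsX R).

(** Double induction, on n and then on r, along Z^(r+1) = Z^r + X Z^(r+3). All powers must be
    treated together because the exponent grows when n drops; 0 < n + r excludes 0 / 0. *)
Lemma fuss_catalan_power (Z : fps R) : Z = 1 + X * Z ^+ 3 ->
  forall n r, (0 < n + r)%N ->
    (Z ^+ r)`@_n = r%:R / (3 * n + r)%:R * 'C(3 * n + r, n)%:R.
Proof.
move=> ZE; have Z0 : Z`@_0 = 1.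
  by rewrite ZE fpscoefD fpscoefXM addr0.
have Zr0 r : (Z ^+ r)`@_0 = 1.
  by elim: r => [//|r IH]; rewrite exprS fpscoefM0 IH Z0 mulr1.
elim=> [|n IHn] r; first by move=> r0; rewrite Zr0 bin0 mulr1 muln0 divff// pnatr_eq0 -lt0n.
move=> _; elim: r => [|r IHr]; first by rewrite mul0r mul0r expr0.
have -> : Z ^+ r.+1 = Z ^+ r + X * Z ^+ (r + 3).
  by rewrite exprSr {2}ZE exprD; ring.
rewrite fpscoefD IHr fpscoefXM IHn; last by rewrite addn3 addnS.
rewrite addn3.
pose m := (3 * n.+1 + r)%N.
have -> : (3 * n + r.+3 = m)%N by rewrite /m; lia.
have -> : (3 * n.+1 + r.+1 = m.+1)%N by rewrite /m; lia.
rewrite -/m.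
have b1 : m.+1%:R * 'C(m, n)%:R = n.+1%:R * 'C(m.+1, n.+1)%:R :> R.
  by rewrite -!natrM -mul_bin_diag.
have b2 : (m%:R - n%:R) * 'C(m, n)%:R = n.+1%:R * 'C(m, n.+1)%:R :> R.
  by rewrite -natrB -?natrM -?mul_bin_left//; rewrite /m; lia.
have mE : m%:R = 3 * n%:R + 3 + r%:R :> R.
  by rewrite /m -natrM natrD natrM -natr1; ring.
have m0 : m%:R != 0 :> R by rewrite pnatr_eq0 /m; lia.
have m1 : m.+1%:R != 0 :> R by rewrite pnatr_eq0.
have n1 : n.+1%:R != 0 :> R by rewrite pnatr_eq0.
have -> : 'C(m, n.+1)%:R = (m%:R - n%:R) * 'C(m, n)%:R / n.+1%:R :> R by rewrite b2 mulrC mulKf.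
have -> : 'C(m.+1, n.+1)%:R = m.+1%:R * 'C(m, n)%:R / n.+1%:R :> R by rewrite b1 mulrC mulKf.
have -> : r.+1%:R / m.+1%:R * (m.+1%:R * 'C(m, n)%:R / n.+1%:R) = r.+1%:R * 'C(m, n)%:R / n.+1%:R :> R.
  by rewrite -[_ / n.+1%:R]mulrA mulrA divfK// mulrA.
have r1E : r.+1%:R = r%:R + 1 :> R by rewrite natr1.
have r3E : r.+3%:R = r%:R + 3 :> R by rewrite -addn3 natrD.
have nE : n.+1%:R = n%:R + 1 :> R by rewrite natr1.
rewrite r1E r3E nE; rewrite nE in n1; rewrite mE in m0 *.
by field; rewrite m0 n1.
Qed.

(** The numbers are the coefficients of M = (Z + Z^2) / 2. With Z = 1 + 2 z this is M = (1 + 2 z)(1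
    + z), and Z = 1 + X Z^3 becomes the third relation after multiplication by 1 + z. *)
Lemma mu0_zeta_rel (M : fps R) :
  (forall n, M`@_n = 'C(3 * n, n)%:R / n.+1%:R) ->
  exists z, zeta_rel 2^-1 2^-1 z M.
Proof.
move=> hM; have [Z ZE] : exists Z, 1 + X * Z ^+ 3 = Z.
  apply: fps_fixpoint => n f g fg; apply: fpseqD; first exact: fpseq_refl.
  by apply: fpseqXM; rewrite !exprS !expr0; do 3!(apply: fpseqM; first exact: fg).
have pw := fuss_catalan_power (esym ZE).
pose h := fpsC (2^-1 : R); have h2 : 2 * h = 1 := half_fpsC R.
have ME : M = h * (Z + Z ^+ 2).
  apply: fpsP => -[|n]; rewrite hM fpscoefCM fpscoefD -{1}[Z]expr1 !pw//.
    by rewrite !muln0 !bin0 !add0n; field.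
  move: n.+1 => {}n.
  have bS k : (3 * n%:R + k.+1%:R - n%:R) * 'C(3 * n + k.+1, n)%:R =
      (3 * n%:R + k.+1%:R) * 'C(3 * n + k, n)%:R :> R.
    rewrite -natrM -natrD -natrB; last by lia.
    by rewrite -!natrM; congr _%:R; rewrite -mul_bin_down addnS.
  have := bS 0%N; have := bS 1%N; rewrite addn0 => b2 b1.
  have p0 (x : R) : 0 < x -> n%:R + x != 0 by move=> x0; rewrite gt_eqF// ltr_wpDl.
  have p3 (x : R) : 0 < x -> 3 * n%:R + x != 0.
    by move=> x0; rewrite gt_eqF// ltr_wpDl// mulr_ge0.
  have p2 (x : R) : 0 < x -> 2 * n%:R + x != 0.
    by move=> x0; rewrite gt_eqF// ltr_wpDl// mulr_ge0.
  have q1 : 2 * n%:R + 1 != 0 :> R by exact: p2.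
  have q2 : 2 * n%:R + 2 != 0 :> R by exact: p2.
  have q3 : 3 * n%:R + 1 != 0 :> R by exact: p3.
  have q4 : 3 * n%:R + 2 != 0 :> R by exact: p3.
  have q5 : n%:R + 1 != 0 :> R by exact: p0.
  have c1 : 'C(3 * n + 1, n)%:R = (3 * n%:R + 1) * 'C(3 * n, n)%:R / (2 * n%:R + 1) :> R.
    by apply: (mulIf q1); rewrite divfK// -b1; ring.
  have c2 : 'C(3 * n + 2, n)%:R = (3 * n%:R + 2) * 'C(3 * n + 1, n)%:R / (2 * n%:R + 2) :> R.
    by apply: (mulIf q2); rewrite divfK// -b2; ring.
  rewrite c2 c1 -natr1; field.
  by rewrite q1 q2 q3 q4 q5.
have Z0 : Z`@_0 = 1 by rewrite -ZE fpscoefD fpscoefXM addr0.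
pose z := h * (Z - 1).
have Zz : Z = 1 + 2 * z by rewrite /z mulrA h2; ring.
have Mz : M = (1 + 2 * z) * (1 + z).
  by rewrite ME Zz; transitivity ((2 * h) * ((1 + 2 * z) * (1 + z))); [ring | rewrite h2 mul1r].
exists z; split.
- by rewrite fpscoefCM fpscoefB Z0 subrr mulr0.
- rewrite -/h Mz; transitivity (1 + 2 * (2 * h) * z * (1 + z) + (2 * h) * z); last by ring.
  by rewrite h2; ring.
- have -> : 2 * z = X * (1 + 2 * z) ^+ 3 by rewrite -Zz; apply: (addrI 1); rewrite ZE -Zz.
  by rewrite -Zz ZE Mz -Zz; ring.
Qed.

End FussCatalan.

(** * Semicircle integrals and Marchenko-Pastur moments *)

Section SemicircleSeries.
Variable R : realFieldType.
Local Notation X := (fpsX R).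
Implicit Types (a b : R) (E M : fps R).

(** The equation of the moment series of the semicircle law of mean a and variance b^2. *)
Definition semicircle_rel a b E := E = 1 + fpsC a * X * E + fpsC b ^+ 2 * X ^+ 2 * E ^+ 2.

Lemma semicircle_ex a b : exists E, semicircle_rel a b E.
Proof.
have [E EE] : exists E, 1 + X * (fpsC a * E + fpsC b ^+ 2 * (X * (E * E))) = E.
  apply: fps_fixpoint => n f g fg; apply: fpseqD; first exact: fpseq_refl.
  apply: fpseqXM; apply: fpseqD; apply: fpseqM; try exact: fpseq_refl; first exact: fg.
  by apply: fpseqM; [exact: fpseq_refl | exact: fpseqM].
by exists E; rewrite /semicircle_rel -{1}EE; ring.
Qed.

(** For M = 1 + X E the quadratic equation becomes M = 1 + X (2 M - 1) M. The family at (1/2, 0)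
    satisfies it too, because (1 + 2 z)^2 = 2 M - 1 there; by uniqueness of the fixed point zeta
    comes without a square root. *)
Lemma mu1_zeta_rel b E M : b ^+ 2 = 2 -> semicircle_rel 3 b E ->
  M`@_0 = 1 -> (forall n, M`@_n.+1 = E`@_n) -> exists z, zeta_rel 2^-1 0 z M.
Proof.
move=> b2 EE M0 MS; pose h := fpsC (2^-1 : R); have h2 : 2 * h = 1 := half_fpsC R.
have ME : M = 1 + X * E.
  by apply: fpsP => -[|n]; rewrite fpscoefD fpscoefXM ?M0 ?addr0// MS add0r.
have c3 : fpsC (3 : R) = 3 by rewrite rmorph_nat.
have cb : fpsC b ^+ 2 = 2 by rewrite -rmorphXn/= b2 rmorph_nat.
have MF : 1 + X * ((2 * M - 1) * M) = M.
  rewrite [RHS]ME EE c3 cb; congr (1 + X * _); rewrite ME; ring.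
have [z [N H]] := zeta_rel_ex (2^-1 : R) 0.
exists z; suff -> : M = N by [].
have [z0 NE zE] := H.
have Nz : N = 1 + 2 * z * (1 + z).
  rewrite NE -/h rmorph0; transitivity (1 + 2 * (2 * h) * z * (1 + z)); first by ring.
  by rewrite h2; ring.
have NF : 1 + X * ((2 * N - 1) * N) = N.
  rewrite [RHS]Nz zE; congr (1 + _); rewrite {1}Nz; ring.
apply: (@fps_fixpoint_uniq _ (fun M => 1 + X * ((2 * M - 1) * M))) => // n f g fg.
apply: fpseqD; first exact: fpseq_refl; apply: fpseqXM; apply: fpseqM => //.
by apply: fpseqD; [apply: fpseqM => //|]; exact: fpseq_refl.
Qed.

(** At (0, 1/2) the relation M = 1 + z makes zeta explicit, and the semicircle equation is E = (1 +
    X E)^2. *)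
Lemma mu2_zeta_rel E M : semicircle_rel 2 1 E ->
  M`@_0 = 1 -> (forall n, M`@_n.+1 = 2^-1 * E`@_n) -> exists z, zeta_rel 0 2^-1 z M.
Proof.
move=> EE M0 MS; pose h := fpsC (2^-1 : R); have h2 : 2 * h = 1 := half_fpsC R.
have ME : M = 1 + X * (h * E).
  by apply: fpsP => -[|n]; rewrite fpscoefD fpscoefXM ?M0 ?addr0// MS fpscoefCM add0r.
have c2 : fpsC (2 : R) = 2 by rewrite rmorph_nat.
have XE : X * E = X * (1 + X * E) ^+ 2.
  by rewrite {1}EE c2 rmorph1; congr (X * _); ring.
have zz : 2 * (X * (h * E)) = X * E.
  by transitivity ((2 * h) * (X * E)); [ring | rewrite h2 mul1r].
exists (X * (h * E)); split.
- by rewrite fpscoefXM.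
- rewrite {1}ME -/h rmorph0; transitivity (1 + (2 * h) * (X * (h * E))); last by ring.
  by rewrite h2 mul1r.
- by rewrite zz {1}XE ME; ring.
Qed.

(* If [semicircle_rel a b E], this is the generating series, by length, of the nonnegative lattice
   paths from height 0 to height k with weight a on level steps and b on up and down steps. *)
Definition path_series b E k := fpsC b ^+ k * X ^+ k * E ^+ k.+1.

(** Split by the last step of the path: level, down from k + 1, or up from k - 1. *)
Lemma path_series_rec a b E : semicircle_rel a b E -> forall k n,
  (path_series b E k)`@_n.+1 = a * (path_series b E k)`@_n + b * (path_series b E k.+1)`@_n
     + (if k is j.+1 then b * (path_series b E j)`@_n else 0).
Proof.
move=> EE k n.
have pE : path_series b E k = fpsC b ^+ k * X ^+ k * E ^+ k +
    X * (fpsC a * path_series b E k + fpsC b * path_series b E k.+1).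
  rewrite /path_series [in LHS]exprSr [X in _ * (_ * X) = _]EE !exprS; ring.
rewrite {1}pE fpscoefD fpscoefXM fpscoefD !fpscoefCM [LHS]addrC; congr (_ + _).
case: k {pE} => [|k]; first by rewrite !expr0 !mulr1.
rewrite (_ : _ * _ = X * (fpsC b * path_series b E k)); last by rewrite /path_series !exprS; ring.
by rewrite fpscoefXM fpscoefCM.
Qed.

Lemma path_series0 a b E k : semicircle_rel a b E -> (path_series b E k)`@_0 = (k == 0%N)%:R.
Proof.
move=> EE; have E0 : E`@_0 = 1.
  by rewrite EE !fpscoefD !fpscoefM0 !(mul0r, mulr0) !addr0.
case: k => [|k]; first by rewrite /path_series !expr0 !mul1r expr1.
by rewrite /path_series exprS [X ^+ _]exprS !fpscoefM0 mul0r mulr0 mul0r.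
Qed.

End SemicircleSeries.

(** * Trigonometric integrals over [0, pi] *)

Section TrigIntegrals.
Variable R : realType.
Local Notation lam := (@lebesgue_measure R).
Local Notation Ipi f := (Rintegral lam `[0%R, pi] f).
Implicit Types (f g : R -> R).

Lemma continuous_integrable_0pi f : continuous f -> lam.-integrable `[0%R, pi] (EFin \o f).
Proof.
move=> cf; apply: continuous_compact_integrable; first exact: segment_compact.
by apply: continuous_subspaceT.
Qed.

Lemma Ipi_ext f g : f =1 g -> Ipi f = Ipi g.
Proof. by move=> fg; apply: eq_Rintegral => x _; exact: fg. Qed.

Lemma IpiD f g : continuous f -> continuous g -> Ipi (fun x => f x + g x) = Ipi f + Ipi g.
Proof. by move=> cf cg; rewrite RintegralD//; exact: continuous_integrable_0pi. Qed.

Lemma IpiZ c f : continuous f -> Ipi (fun x => c * f x) = c * Ipi f.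
Proof. by move=> cf; rewrite RintegralZl//; exact: continuous_integrable_0pi. Qed.

Lemma sin_natpi n : sin (n%:R * pi) = 0 :> R.
Proof.
elim: n => [|n IH]; first by rewrite mul0r sin0.
by rewrite -natr1 mulrDl mul1r sinDpi IH oppr0.
Qed.

Lemma continuous_cosM (c : R) : continuous (fun x : R => cos (c * x)).
Proof. by move=> x; apply: continuous_comp; [exact: mulrl_continuous | exact: continuous_cos]. Qed.

Lemma continuous_sinM (c : R) : continuous (fun x : R => sin (c * x)).
Proof. by move=> x; apply: continuous_comp; [exact: mulrl_continuous | exact: continuous_sin]. Qed.

Lemma Ipi_cos0 : Ipi (fun x => cos (0%:R * x)) = pi.
Proof.
rewrite (@Ipi_ext _ (cst 1)); last by move=> x; rewrite mul0r cos0.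
rewrite Rintegral_cst//= lebesgue_measure_itv/= lte_fin pi_gt0.
by rewrite oppr0 adde0 mul1r.
Qed.

Lemma Ipi_cosS n : Ipi (fun x => cos (n.+1%:R * x)) = 0.
Proof.
pose F x : R := n.+1%:R^-1 * sin (n.+1%:R * x).
have n0 : n.+1%:R != 0 :> R by rewrite pnatr_eq0.
have dF (x : R) : is_derive x 1 F (cos (n.+1%:R * x)).
  rewrite /F; apply: is_derive_eq.
  by rewrite !scaler1 /GRing.scale/= mulrCA mulVf// mulr1.
rewrite /Rintegral (@continuous_FTC2 _ _ F 0 pi) ?pi_gt0//.
- by rewrite /F sin_natpi !mulr0 sin0 mulr0 -EFinB subrr.
- by apply: continuous_subspaceT; exact: continuous_cosM.
- have cF : continuous F.
    by move=> x; apply: differentiable_continuous; apply/derivable1_diffP; exact: ex_derive.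
  split.
  + by move=> x _; exact: ex_derive.
  + by apply: cvg_at_right_filter; exact: cF.
  + by apply: cvg_at_left_filter; exact: cF.
- by move=> x _; rewrite derive1E derive_val.
Qed.

Lemma sin_sin (j : nat) (x : R) :
  sin (j.+1%:R * x) * sin x = 2^-1 * (cos (j%:R * x) - cos (j.+2%:R * x)).
Proof.
have -> : j%:R * x = j.+1%:R * x - x by rewrite -natr1; ring.
have -> : j.+2%:R * x = j.+1%:R * x + x by rewrite -[j.+2%:R]natr1; ring.
by rewrite cosB cosD; field.
Qed.

Lemma sin_cos (j : nat) (x : R) :
  2 * cos x * sin (j.+1%:R * x) = sin (j.+2%:R * x) + sin (j%:R * x).
Proof.
have -> : j%:R * x = j.+1%:R * x - x by rewrite -natr1; ring.
have -> : j.+2%:R * x = j.+1%:R * x + x by rewrite -[j.+2%:R]natr1; ring.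
by rewrite sinB sinD; ring.
Qed.

Section Moment.
Variables (a b : R) (E : fps R).
Hypothesis EE : semicircle_rel a b E.

Let G n j (x : R) := (a + 2 * b * cos x) ^+ n * (sin (j%:R * x) * sin x).

Let cG n j : continuous (G n j).
Proof.
move=> x; apply: cvgM.
  apply: cvg_exprn; apply: cvgD; first exact: cvg_cst.
  by apply: cvgM; [exact: cvg_cst | exact: continuous_cos].
by apply: cvgM; [exact: continuous_sinM | exact: continuous_sin].
Qed.

(** By [sin_cos], one more factor a + 2 b cos x acts on sin (j x) as one step of a path at height j
    - 1; sin 0 = 0 is the barrier below height 0. Orthogonality of the sines gives the start n =
    0. *)
Let G_path n j : Ipi (G n j) = pi / 2 * (if j is k.+1 then (path_series b E k)`@_n else 0).
Proof.
elim: n j => [|n IH] [|j].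
- rewrite (@Ipi_ext _ (cst 0)) ?Rintegral_cst// ?mul0r ?mulr0//.
  by move=> x; rewrite /G mul0r sin0 mul0r mulr0.
- rewrite (@Ipi_ext _ (fun x => 2^-1 * (cos (j%:R * x) + (- 1) * cos (j.+2%:R * x)))); last first.
    by move=> x; rewrite /G expr0 mul1r sin_sin mulN1r.
  have cc k : continuous (fun x : R => cos (k%:R * x)) by exact: continuous_cosM.
  have cc' k : continuous (fun x : R => (- 1) * cos (k%:R * x)).
    by move=> x; apply: cvgM; [exact: cvg_cst | exact: cc].
  rewrite IpiZ; last by move=> x; apply: cvgD; [exact: cc|exact: cc'].
  rewrite IpiD// IpiZ// Ipi_cosS mulr0 addr0 (path_series0 _ EE).
  case: j => [|j]; first by rewrite Ipi_cos0 mulr1 mulrC.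
  by rewrite Ipi_cosS !mulr0.
- rewrite (@Ipi_ext _ (cst 0)) ?Rintegral_cst// ?mul0r ?mulr0//.
  by move=> x; rewrite /G mul0r sin0 mul0r mulr0.
rewrite (@Ipi_ext _ (fun x => a * G n j.+1 x + (b * G n j.+2 x + b * G n j x))); last first.
  move=> x; rewrite /G.
  transitivity ((a + 2 * b * cos x) ^+ n *
    (a * sin (j.+1%:R * x) + b * (2 * cos x * sin (j.+1%:R * x))) * sin x).
    by rewrite exprS; ring.
  by rewrite sin_cos; ring.
have cZ c k : continuous (fun x => c * G n k x).
  by move=> x; apply: cvgM; [exact: cvg_cst | exact: cG].
rewrite IpiD//; last by move=> x; apply: cvgD; exact: cZ.
rewrite IpiD// !IpiZ// !IH (path_series_rec EE).
by case: j => [|j]; ring.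
Qed.

Lemma Ipi_semicircle n :
  Ipi (fun x => (a + 2 * b * cos x) ^+ n * (sin x * sin x)) = pi / 2 * E`@_n.
Proof.
have := G_path n 1%N; rewrite /path_series expr0 expr0 !mul1r expr1 => <-.
by apply: Ipi_ext => x; rewrite /G mul1r.
Qed.

End Moment.

(** Substitution of a + 2 b cos x for the variable, decreasing on [0, pi], where the root becomes 2
    b sin x. The factor c is there for dilated laws. *)
Lemma semicircle_integral (c a b : R) (E : fps R) n :
    0 < b -> semicircle_rel (c * a) (c * b) E ->
  (\int[lam]_(x in `[(a - 2 * b)%R, (a + 2 * b)%R])
     ((c * x) ^+ n * Num.sqrt (4 * b ^+ 2 - (x - a) ^+ 2))%:E =
   (2 * pi * b ^+ 2 * E`@_n)%:E)%E.
Proof.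
move=> b0 EE; pose F (x : R) := a + 2 * b * cos x.
have b20 : 0 < 2 * b by rewrite mulr_gt0.
have F0 : F 0 = a + 2 * b by rewrite /F cos0 mulr1.
have Fpi : F pi = a - 2 * b by rewrite /F cospi mulrN1.
have dF (x : R) : is_derive x 1 F (- (2 * b * sin x)).
  rewrite /F; apply: is_derive_eq.
  by rewrite add0r mul1r /GRing.scale/= mulrN.
have cF : continuous F.
  by move=> x; apply: differentiable_continuous; apply/derivable1_diffP; exact: ex_derive.
have F'E : derive1 F = fun x => - (2 * b * sin x).
  by apply/funext => x; rewrite derive1E derive_val.
have cF' : continuous (fun x : R => - (2 * b * sin x)).
  by move=> x; apply: cvgN; apply: cvgM; [exact: cvg_cst|exact: continuous_sin].
have := @integration_by_substitution_decreasing R F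
  (fun x => (c * x) ^+ n * Num.sqrt (4 * b ^+ 2 - (x - a) ^+ 2)) 0 pi (pi_ge0 R).
rewrite F0 Fpi F'E => ->.
- have IE := Ipi_semicircle EE n.
  have cH : continuous (fun x => (c * a + 2 * (c * b) * cos x) ^+ n * (sin x * sin x)).
    move=> x; apply: cvgM; last by apply: cvgM; exact: continuous_sin.
    apply: cvg_exprn; apply: cvgD; first exact: cvg_cst.
    by apply: cvgM; [exact: cvg_cst | exact: continuous_cos].
  transitivity ((4 * b ^+ 2 *
    Ipi (fun x => (c * a + 2 * (c * b) * cos x) ^+ n * (sin x * sin x)))%:E)%E; last first.
    by rewrite IE; congr (_%:E); field.
  rewrite -IpiZ// /Rintegral fineK.
    apply: eq_integral => x; rewrite inE/= in_itv/= => /andP[x0 xpi]; congr (_%:E).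
    change ((c * F x) ^+ n * Num.sqrt (4 * b ^+ 2 - (F x - a) ^+ 2) * - - (2 * b * sin x) =
      4 * b ^+ 2 * ((c * a + 2 * (c * b) * cos x) ^+ n * (sin x * sin x))).
    have s0 : 0 <= sin x by rewrite sin_ge0_pi// x0.
    have -> : 4 * b ^+ 2 - (F x - a) ^+ 2 = (2 * b * sin x) ^+ 2.
      by rewrite /F; have := cos2Dsin2 x => h; nra.
    rewrite sqrtr_sqr ger0_norm ?mulr_ge0 ?(ltW b0)//.
    rewrite (_ : c * F x = c * a + 2 * (c * b) * cos x); last by rewrite /F; ring.
    by ring.
  apply: integrable_fin_num => //; apply: continuous_integrable_0pi.
  by move=> x; apply: cvgM; [exact: cvg_cst|exact: cH].
- move=> x y x0 y0 xy; rewrite /F ltrD2l ltr_pM2l//.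
  by rewrite ltr_cos.
- by move=> x _; exact: cF'.
- by apply/cvg_ex; exists (- (2 * b * sin 0)); apply: cvg_at_right_filter; exact: cF'.
- by apply/cvg_ex; exists (- (2 * b * sin pi)); apply: cvg_at_left_filter; exact: cF'.
- split.
  + by move=> x _; exact: ex_derive.
  + by apply: cvg_at_right_filter; exact: cF.
  + by apply: cvg_at_left_filter; exact: cF.
- apply: continuous_subspaceT => x; apply: cvgM.
    by apply: cvg_exprn; exact: mulrl_continuous.
  apply: continuous_comp; last exact: sqrt_continuous.
  apply: cvgB; first exact: cvg_cst.
  by apply: cvg_exprn; apply: cvgB; [exact: cvg_id | exact: cvg_cst].
Qed.

End TrigIntegrals.

(** * Integration against a measure with density *)

Section Density.
Local Open Scope ereal_scope.
Context d (T : measurableType d) (R : realType).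
Variables (mu : {measure set T -> \bar R}) (g : T -> R).
Hypothesis mg : measurable_fun setT g.
Hypothesis g0 : forall x, (0 <= g x)%R.

Lemma density_measure_ex : exists D : {measure set T -> \bar R},
  forall A, measurable A -> D A = \int[mu]_(x in A) (g x)%:E.
Proof.
pose D A := \int[mu]_(x in A) (g x)%:E.
have mgE : measurable_fun setT (EFin \o g) by exact/measurable_EFinP.
have D0 : D set0 = 0 by rewrite /D integral_set0.
have Dge0 A : 0 <= D A by apply: integral_ge0 => x _; rewrite lee_fin.
have Dadd : semi_sigma_additive D.
  move=> /= F mF tF mUF; rewrite /D; apply: cvg_toP.
    apply: ereal_nondecreasing_is_cvgn => m n mn.
    apply: lee_sum_nneg_natr => // k _ _.
    by apply: integral_ge0 => /= x Fkx; rewrite lee_fin.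
  rewrite ge0_integral_bigcup//=.
  - exact: measurable_funTS.
  - by move=> x _; rewrite lee_fin.
pose DM : {measure set T -> \bar R} := HB.pack D (isMeasure.Build _ _ _ D D0 Dge0 Dadd).
by exists DM.
Qed.

Import HBNNSimple.

(** Monotone convergence along simple approximations of f, for which both sides are sums over level
    sets. *)
Lemma ge0_integral_density (D : {measure set T -> \bar R}) (f : T -> \bar R) :
    (forall A, measurable A -> D A = \int[mu]_(x in A) (g x)%:E) ->
    measurable_fun setT f -> (forall x, 0 <= f x) ->
  \int[D]_x f x = \int[mu]_x (f x * (g x)%:E).
Proof.
move=> hD mf f0; have mgE : measurable_fun setT (EFin \o g) by exact/measurable_EFinP.
pose h := nnsfun_approx measurableT mf.
transitivity (lim ((\int[D]_x (h n x)%:E) @[n --> \oo])).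
  rewrite -monotone_convergence//=.
  - apply: eq_integral => x _; apply/esym/cvg_lim => //.
    exact: cvg_nnsfun_approx.
  - by move=> n; exact/measurable_EFinP/measurable_funTS.
  - by move=> n x _; rewrite lee_fin.
  - by move=> x _ a b ab; rewrite lee_fin; exact/lefP/nd_nnsfun_approx.
transitivity (lim ((\int[mu]_x ((h n x)%:E * (g x)%:E)) @[n --> \oo])); last first.
  rewrite -monotone_convergence//=.
  - apply: eq_integral => x _; apply: cvg_lim => //.
    by apply: cvgeZr => //; exact: cvg_nnsfun_approx.
  - move=> n; apply: emeasurable_funM => //; exact/measurable_EFinP/measurable_funTS.
  - by move=> n x _; rewrite mule_ge0// lee_fin.
  - by move=> x _ a b ab; rewrite lee_wpmul2r ?lee_fin//; exact/lefP/nd_nnsfun_approx.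
apply: congr_lim; apply/funext => n /=.
rewrite integralT_nnsfun sintegralE.
have ind0 r x : 0 <= (r * \1_(h n @^-1` [set r]) x)%:E by exact: nnfun_muleindic_ge0.
transitivity (\int[mu]_x (\sum_(y \in range (h n))
    ((y * \1_(h n @^-1` [set y]) x)%:E * (g x)%:E))); last first.
  apply: eq_integral => x _.
  by rewrite -ge0_mule_fsuml// fsumEFin// -(fimfunE _ x).
have mind r : measurable_fun setT (fun x => (r * \1_(h n @^-1` [set r]) x)%:E).
  by apply/measurable_EFinP; exact: measurable_funM.
rewrite ge0_integral_fsum//; last 2 first.
  - by move=> r; exact: emeasurable_funM.
  - by move=> r x _; rewrite mule_ge0// lee_fin.
apply: eq_fsbigr => r /[!inE] -[x0 _ rE].
have r0 : (0 <= r)%R by rewrite -rE.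
rewrite hD//.
under [RHS]eq_integral do rewrite EFinM -muleA.
rewrite ge0_integralZl//.
- congr (_ * _); rewrite integral_mkcond; apply: eq_integral => x _.
  by rewrite muleC epatch_indic.
- by apply: emeasurable_funM => //; exact/measurable_EFinP.
- by move=> x _; rewrite mule_ge0// lee_fin.
Qed.

End Density.

Section MarchenkoPastur.
Variable R : realType.
Local Notation lam := (@lebesgue_measure R).

Lemma mp_density_ge0 (t x : R) : 0 <= mp_density t x.
Proof.
rewrite /mp_density; case: ifPn => // /andP[x0 _].
rewrite divr_ge0 ?sqrtr_ge0// mulr_ge0 ?mulr_ge0 ?pi_ge0//.
by apply: le_trans x0; rewrite sqr_ge0.
Qed.

(** The interval reaches 0 when t = 1; the value there is 0 because the inverse of 0 is 0. *)
Lemma mp_density_le0 (t x : R) : x <= 0 -> mp_density t x = 0.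
Proof.
move=> x0; rewrite /mp_density; case: ifPn => // /andP[h _].
have -> : x = 0 by apply/le_anti; rewrite x0 (le_trans _ h)// sqr_ge0.
by rewrite mulr0 invr0 mulr0.
Qed.

Lemma measurable_mp_density (t : R) : measurable_fun [set: measurableTypeR R] (mp_density t).
Proof.
pose f (x : R) := Num.sqrt (4 * t - (x - 1 - t) ^+ 2) / (2 * pi * x).
pose S : set R := `[(1 - Num.sqrt t) ^+ 2, (1 + Num.sqrt t) ^+ 2]%classic.
have fE : mp_density t = (f \_ S) \_ `]0%R, +oo[%classic.
  apply/funext => x; rewrite patchE; case: ifPn => x0.
    rewrite patchE /mp_density; case: ifPn => [h|h]; first by rewrite mem_set.
    have xS : ~ S x by rewrite /S/= in_itv/=; exact/negP.
    by rewrite memNset.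
  apply: mp_density_le0; rewrite leNgt; apply/negP => x1.
  by move/negP: x0; apply; rewrite inE/= in_itv/= x1.
rewrite fE; apply/(measurable_restrictT _ _).1 => //.
rewrite /S.
have mf : measurable_fun (`]0%R, +oo[%classic : set R) f.
  apply: open_continuous_measurable_fun; first exact: interval_open.
  move=> x; rewrite inE/= in_itv/= andbT => x0.
  apply: cvgM.
    apply: continuous_comp; last exact: sqrt_continuous.
    apply: cvgB; first exact: cvg_cst.
    apply: cvg_exprn; apply: cvgB; last exact: cvg_cst.
    by apply: cvgB; [exact: cvg_id | exact: cvg_cst].
  apply: cvgV; first by rewrite mulf_neq0 ?mulf_neq0 ?gt_eqF ?pi_gt0.
  by apply: cvgM; [exact: cvg_cst | exact: cvg_id].
apply/(measurable_restrict _ _ _).1 => //.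
by apply: measurable_funS mf => // x [].
Qed.

Section Moments.
Variables (mu : probability R R) (c0 c1 d b a : R) (E : fps R).
Hypotheses (c00 : 0 <= c0) (c10 : 0 <= c1) (d0 : 0 < d) (b0 : 0 < b).
Hypothesis EE : semicircle_rel (d * (1 + b ^+ 2)) (d * b) E.
Let t := b ^+ 2.
Hypothesis muE : forall A, measurable A ->
  mu A = (c0%:E * \d_(0%R : R) A + c1%:E * \int[lam]_(x in ( *%R d) @^-1` A) (mp_density t x)%:E)%E.

Let mden := @measurable_mp_density t.

Lemma ge0_integral_mp (f : R -> \bar R) : measurable_fun setT f -> (forall x, 0 <= f x)%E ->
  (\int[mu]_x f x = c0%:E * f 0%R + c1%:E * \int[lam]_x (f (d * x)%R * (mp_density t x)%:E))%E.
Proof.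
move=> mf f0.
have [D hD] := density_measure_ex lam mden (@mp_density_ge0 t).
have md : measurable_fun [set: measurableTypeR R] (( *%R d) : measurableTypeR R -> R).
  exact: mulrl_measurable.
pose C0 := NngNum c00; pose C1 := NngNum c10.
pose P : {measure set R -> \bar R} := 
  measure_function_pushforward__canonical__measure_function_Measure D md.
pose nu : {measure set R -> \bar R} := measure_add (mscale C0 (dirac (0:R))) (mscale C1 P).
rewrite (@eq_measure_integral _ _ _ setT nu).
  rewrite ge0_integral_measure_add// !ge0_integral_mscale//.
  rewrite integral_dirac// diracT mul1e; congr (_ + _ * _)%E.
  rewrite ge0_integral_pushforward//= preimage_setT.
  rewrite (@ge0_integral_density _ _ _ lam _ mden (@mp_density_ge0 t) D)//.
  exact: measurableT_comp.
move=> A mA _; rewrite [RHS]measure_addE /mscale/= muE//; congr (_ + _ * _)%E.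
have -> : P A = D (( *%R d) @^-1` A) by [].
by rewrite hD// -[X in measurable X]setTI; exact: (md measurableT).
Qed.

(** One factor x cancels the 1 / x of the density and kills the atom at 0, leaving a semicircle
    integral of centre 1 + b^2 and radius 2 b with t = b^2. The weights c0, c1 and the dilation d
    cover mu1 and mu2 together. *)
Lemma mp_moment n : moment mu n.+1 = (c1 * d * b ^+ 2 * E`@_n)%:E.
Proof.
have mneg : measurable (`]-oo, 0[%classic : set R) by [].
have neg0 : mu `]-oo, 0[%classic = 0%E.
  rewrite muE// diracE memNset ?mule0 ?add0e; last by rewrite /= in_itv/= ltxx.
  rewrite integral0_eq ?mule0// => x /=; rewrite in_itv/= pmulr_rlt0// => x0.
  by rewrite mp_density_le0// ltW.
have mX : measurable_fun [set: R] (fun x : R => x ^+ n.+1) by exact: measurable_funX.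
(* mu has no mass on the negative half-line, so the absolute value changes nothing and makes
   [ge0_integral_mp] applicable to odd powers too. *)
rewrite /moment (@ae_eq_integral _ _ _ _ setT (fun x : R => (`|x| ^+ n.+1)%:E))//; last 3 first.
- exact/measurable_EFinP.
- apply/measurable_EFinP; apply: measurable_funX; exact: measurable_realfun.normr_measurable.
- exists `]-oo, 0[%classic; split => // x /=; rewrite in_itv/= => h.
  rewrite ltNge; apply/negP => x0; apply: h => _; by rewrite ger0_norm.
rewrite ge0_integral_mp; last 2 first.
- apply/measurable_EFinP; apply: measurable_funX; exact: measurable_realfun.normr_measurable.
- by move=> x; rewrite lee_fin exprn_ge0.
rewrite normr0 expr0n/= mule0 add0e.
have pi0 : pi != 0 :> R by rewrite gt_eqF// pi_gt0.
have Sb : Num.sqrt t = b by rewrite sqrtr_sqr ger0_norm// ltW.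
have e1 : (1 - b) ^+ 2 = (1 + b ^+ 2) - 2 * b by ring.
have e2 : (1 + b) ^+ 2 = (1 + b ^+ 2) + 2 * b by ring.
pose k (x : R) := (d * x) ^+ n * Num.sqrt (4 * b ^+ 2 - (x - (1 + b ^+ 2)) ^+ 2).
have -> : (\int[lam]_x ((`|d * x| ^+ n.+1)%:E * (mp_density t x)%:E) =
   \int[lam]_(x in `[((1 + b ^+ 2) - 2 * b)%R, ((1 + b ^+ 2) + 2 * b)%R]) ((d / (2 * pi))%:E * (k x)%:E))%E.
  rewrite [RHS]integral_mkcond; apply: eq_integral => x _; rewrite patchE.
  rewrite /mp_density Sb e1 e2; case: ifPn => h; last first.
    by rewrite mule0 memNset//= in_itv/=; exact/negP.
  rewrite mem_set/=; last by rewrite in_itv.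
  have x0 : 0 <= x by case/andP: h => + _; apply: le_trans; rewrite -e1 sqr_ge0.
  rewrite -!EFinM; congr (_%:E); rewrite ger0_norm ?mulr_ge0 ?(ltW d0)// /k /t.
  have -> : x - 1 - b ^+ 2 = x - (1 + b ^+ 2) by ring.
  (* At x = 0 the factor x cannot be cancelled. There the radicand is -(1 - b^2)^2 <= 0, and the
     square root of a nonpositive number is 0. *)
  have [->|xn0] := eqVneq x 0.
    rewrite mulr0 expr0n/= mul0r sub0r sqrrN.
    rewrite ler0_sqrtr ?mulr0 ?mulr0// subr_le0.
    have := sqr_ge0 (1 - b ^+ 2); nra.
  by rewrite exprS; move: (pi : R) pi0 => p p0; field; rewrite p0 xn0.
rewrite ge0_integralZl//; last 3 first.
- apply/measurable_EFinP; apply: measurable_funTS; apply: continuous_measurable_fun => x.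
  apply: cvgM; first by apply: cvg_exprn; exact: mulrl_continuous.
  apply: continuous_comp; last exact: sqrt_continuous.
  apply: cvgB; first exact: cvg_cst.
  by apply: cvg_exprn; apply: cvgB; [exact: cvg_id | exact: cvg_cst].
- move=> x; rewrite /= in_itv/= => /andP[x0 _]; rewrite lee_fin /k mulr_ge0 ?sqrtr_ge0//.
  by rewrite exprn_ge0// mulr_ge0 ?(ltW d0)// (le_trans _ x0)// -e1 sqr_ge0.
- by rewrite lee_fin divr_ge0 ?mulr_ge0 ?pi_ge0// ltW.
rewrite (semicircle_integral n b0 EE) -!EFinM; congr (_%:E).
by move: (pi : R) pi0 => p p0; field.
Qed.

End Moments.

End MarchenkoPastur.

(** * Identification of the three laws *)

Section Main.
Variable R : realType.
Implicit Types mu : probability R R.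

Lemma moment0 mu : moment mu 0 = 1%E.
Proof.
rewrite /moment (eq_integral (cst 1%E)) => [|x _]; last by rewrite expr0.
rewrite integral_cst// mul1e; exact: probability_setT.
Qed.

Lemma in_family_mu0 mu :
  (forall n : nat, moment mu n = ('C(3 * n, n)%:R / n.+1%:R : R)%:E) ->
  in_family 2^-1 2^-1 mu.
Proof.
move=> hmu; pose M : fps R := Fps (fun n => 'C(3 * n, n)%:R / n.+1%:R).
have [z zM] := @mu0_zeta_rel R M (fun n => erefl).
by apply: zeta_rel_in_family zM _; rewrite ?invr_ge0.
Qed.

Lemma in_family_mu1 mu :
  (forall A : set R, measurable A -> mu A = dilation 2 (marchenko_pastur (2^-1)) A) ->
  in_family 2^-1 0 mu.
Proof.
move=> hmu; pose b : R := Num.sqrt 2^-1.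
have b2 : b ^+ 2 = 2^-1 by rewrite sqr_sqrtr ?invr_ge0.
have b0 : 0 < b by rewrite sqrtr_gt0 invr_gt0.
(* With d = 2 and b^2 = 1/2, the centre is d (1 + b^2) = 3, (d b)^2 = 2 as [mu1_zeta_rel] requires,
   and d b^2 = 1, so moment n + 1 is exactly coefficient n of E. *)
have [E EE] := semicircle_ex 3 (2 * b).
have muE A : measurable A -> mu A = ((2^-1)%:E * \d_(0%R : R) A +
    1%:E * \int[lebesgue_measure]_(x in ( *%R 2) @^-1` A) (mp_density (b ^+ 2) x)%:E)%E.
  move=> mA; rewrite hmu// /dilation /marchenko_pastur b2 mul1e.
  have -> : [set a / 2 | a in A] = ( *%R 2) @^-1` A.
    apply/seteqP; split => x /=.
      by move=> [a Aa <-]; rewrite mulrC divfK.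
    by move=> Ax; exists (2 * x) => //; rewrite mulrC mulKf.
  have -> : Num.max (1 - 2^-1) 0 = 2^-1 :> R.
    by rewrite max_l; lra.
  congr (_ * _ + _)%E; rewrite !diracE.
  by have -> : ((0 : R) \in ( *%R 2) @^-1` A) = (0 \in A) by apply/idP/idP; rewrite !inE/= mulr0.
pose M : fps R := Fps (fun n => if n is m.+1 then E`@_m else 1).
have [z zM] : exists z, zeta_rel 2^-1 0 z M.
  apply: (@mu1_zeta_rel _ (2 * b) E) => //.
  by rewrite exprMn b2; field.
apply: zeta_rel_in_family zM _; rewrite ?invr_ge0// => -[|n]; first exact: moment0.
rewrite (@mp_moment _ mu 2^-1 1 2 b E) ?invr_ge0//=.
  by rewrite b2; congr (_%:E); field.
by rewrite (_ : 2 * (1 + b ^+ 2) = 3)// b2; field.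
Qed.

Lemma in_family_mu2 mu :
  (forall A : set R, measurable A ->
     mu A = (2^-1%:E * \d_(0%R:R) A + 2^-1%:E * marchenko_pastur 1 A)%E) ->
  in_family 0 2^-1 mu.
Proof.
move=> hmu.
have [E EE] := semicircle_ex (2 : R) 1.
have muE A : measurable A -> mu A = ((2^-1)%:E * \d_(0%R : R) A +
    (2^-1)%:E * \int[lebesgue_measure]_(x in ( *%R 1) @^-1` A) (mp_density (1 ^+ 2) x)%:E)%E.
  move=> mA; rewrite hmu// /marchenko_pastur subrr maxxx mul0e add0e expr1n.
  have -> : ( *%R 1) @^-1` A = A by apply/seteqP; split => x /=; rewrite mul1r.
  by [].
pose M : fps R := Fps (fun n => if n is m.+1 then 2^-1 * E`@_m else 1).
have [z zM] : exists z, zeta_rel 0 2^-1 z M by exact: (@mu2_zeta_rel _ E).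
apply: zeta_rel_in_family zM _; rewrite ?invr_ge0// => -[|n]; first exact: moment0.
rewrite (@mp_moment _ mu 2^-1 2^-1 1 1 E) ?invr_ge0//=.
  by rewrite mulr1 expr1n mulr1.
by rewrite !mul1r expr1n.
Qed.

End Main.

Theorem mainTheorem6 (R : realType) (mu0 mu1 mu2 : probability R R) :
  (forall n : nat,
     moment mu0 n = ('C(3 * n, n)%:R / n.+1%:R : R)%:E) ->
  (forall A : set R, measurable A ->
     mu1 A = dilation 2 (marchenko_pastur (2^-1)) A) ->
  (forall A : set R, measurable A ->
     mu2 A = (2^-1%:E * \d_(0%R:R) A + 2^-1%:E * marchenko_pastur 1 A)%E) ->
  [/\ is_free_conv mu0 mu1 mu2,
      free_inf_divisible mu1,
      free_inf_divisible mu2 &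
      free_inf_divisible mu0].
Proof.
move=> /in_family_mu0 h0 /in_family_mu1 h1 /in_family_mu2 h2.
have half0 : 0 <= 2^-1 :> R by rewrite invr_ge0.
split.
- by apply: in_family_conv h1 h2; rewrite addr0 add0r.
- exact: in_family_inf_divisible h1.
- exact: in_family_inf_divisible h2.
- exact: in_family_inf_divisible h0.
Qed.
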